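(* Let $k$ be an algebraically closed field, let $d,n,r\ge 0$ be integers with $r<n$, and let $\mathcal S_{(\delta,a,b)}$, $(\delta,a,b)\in\mathcal F$, be any $T$-fixed point of the quot scheme $\mathcal Q_d=\mathcal Q_d(r,n)$. The set of tangent directions at $\mathcal S_{(\delta,a,b)}$ to the $T$-invariant curves through it induced by the sheaves of types I, II, and III (see context) corresponds to the $T$-basis of $T_{(\delta,a,b)}\mathcal Q_d$ given in the context, and this correspondence is $T$-equivariant, respecting the weights. More specifically, at the $T$-fixed point $\mathcal S_{(\delta,a,b)}$ (the point $[s,t]=[1,0]$ of the curve): (I) The weight of the type I curve (in positions $i,j$, connecting to $(\delta',a',b')$) is $\mathbf e_j-\mathbf e_i+(a'_j-a_i)\mathbf f$, and such curves correspond to the first summand, $\bigoplus_{\delta_i=1}\bigoplus_{\delta_j=0}\mathrm{Hom}(\mathcal S_{a_i,b_i},\mathcal O_{\mathbb P^1})\cdot\mathbf E_{ij}$, of the tangent space. (II) The weight of the type II curve of the first kind (where $b=b'$) is $\mathbf e_j-\mathbf e_i+(a'_j-a_i)\mathbf f$, the weight of the type II curve of the second kind (where $a=a'$) is $\mathbf e_j-\mathbf e_i+(b_i-b'_j)\mathbf f$, and such curves correspond to the part of the second summand, $\bigoplus_{\delta_i=1}\bigoplus_{\delta_j=1}\mathrm{Hom}(\mathcal S_{a_i,b_i},\mathcal T_{a_j,b_j})\cdot\mathbf E_{ij}$, with $i\ne j$. (III) The weight of the type III curve (in position $i$) is $(a'_i-a_i)\mathbf f$, and such curves correspond to the part of the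 second summand with $i=j$.
   Context: $\mathcal Q_d(r,n)$ is the quot scheme over $k$ parametrizing quotient sheaves on $\mathbb P^1$ of $\mathcal O_{\mathbb P^1}^n=k^n\otimes\mathcal O_{\mathbb P^1}$ of rank $r$ and degree $d$; a point is identified with the kernel subsheaf. $k^n$ has basis $\mathbf e_1,\dots,\mathbf e_n$ with dual basis $\hat{\mathbf e}_i$; $\mathbf E_{ij}=\hat{\mathbf e}_i\otimes\mathbf e_j$. $[x,y]$ are coordinates on $\mathbb P^1$ with $x$ vanishing at $0$, $y$ at $\infty$, and $z=x/y$. $T=T_{k^n}\times T_{\mathbb P^1}$, with $T_{k^n}=(\mathbb G_m)^n$ diagonal on $k^n$ and $T_{\mathbb P^1}=\mathbb G_m$ acting by $q\cdot x=qx$, $q\cdot y=y$. The character of $T$ on the basis vector $\mathbf e_i$ is also denoted $\mathbf e_i$ (so $\hat{\mathbf e}_i$ has weight $-\mathbf e_i$), and $\mathbf f$ is the character of $T$ on $z$, so $z^c\mathbf E_{ij}$ has weight $\mathbf e_j-\mathbf e_i+c\,\mathbf f$. $\mathcal F$ is the set of triples $(\delta,a,b)$ with $\delta\in\{0,1\}^n$, $\sum_i\delta_i=n-r$, $a,b\in(\mathbb Z_{\ge0})^n$, $\sum_i(a_i+b_i)=d$, and $a_i=b_i=0$ whenever $\delta_i=0$. The fixed point is $\mathcal S_{(\delta,a,b)}=\bigoplus_{\delta_i=1}\mathcal S_{a_i,b_i}\cdot\mathbf e_i$, where $\mathcal S_{a,b}$ is the image of $\mathcal O_{\mathbb P^1}(-a-b)\xrightarrow{x^ay^b}\mathcal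 O_{\mathbb P^1}$; also $\mathcal T_{a,b}=\mathcal O_{\mathbb P^1}/\mathcal S_{a,b}=\mathcal O_{\mathbb P^1}/\mathfrak m_0^a\oplus\mathcal O_{\mathbb P^1}/\mathfrak m_\infty^b$. Tangent space and its $T$-basis: $T_{(\delta,a,b)}\mathcal Q_d=\mathrm{Hom}(\mathcal S_{(\delta,a,b)},\mathcal O^n_{\mathbb P^1}/\mathcal S_{(\delta,a,b)})$ is the direct sum of the two summands displayed in (I) and (II). The $T$-basis is: for $\delta_i=1,\delta_j=0$, the elements $z^c\mathbf E_{ij}$ with $-a_i\le c\le b_i$; for $\delta_i=\delta_j=1$ ($i=j$ allowed), the elements $z^{(a_j-c)-a_i}\mathbf E_{ij}$ with $1\le c\le a_j$ (acting as zero on stalks at $\infty$), of weight $\mathbf e_j-\mathbf e_i+((a_j-c)-a_i)\mathbf f$, and the elements $z^{b_i-(b_j-c)}\mathbf E_{ij}$ with $1\le c\le b_j$ (acting as zero on stalks at $0$), of weight $\mathbf e_j-\mathbf e_i+(b_i-(b_j-c))\mathbf f$. Curves: let $[s,t]$ be coordinates on a second $\mathbb P^1$ and $\mathcal O$ the structure sheaf of $\mathbb P^1_{[x,y]}\times\mathbb P^1_{[s,t]}$. Let $(\delta',a',b')\in\mathcal F$ be another fixed point. The following subsheaves $\mathcal S\subset\mathcal O^n$ (each agreeing with both $\mathcal S_{(\delta,a,b)}$ and $\mathcal S_{(\delta',a',b')}$ outside the indicated components) define $T$-invariant curves on $\mathcal Q_d$ with value $\mathcal S_{(\delta,a,b)}$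 at $[s,t]=[1,0]$ and $\mathcal S_{(\delta',a',b')}$ at $[0,1]$. Type I: $(\delta,a,b)$ and $(\delta',a',b')$ agree except in positions $i$ and $j$, with $\delta_i=\delta'_j=1$, $\delta_j=\delta'_i=0$. The component of $\mathcal S$ in $\mathcal O\mathbf e_i+\mathcal O\mathbf e_j$ is generated by $s x^{a_i}y^{b_i}\mathbf e_i+t x^{a'_j}y^{b'_j}\mathbf e_j$. Type II, first kind: $\delta=\delta'$, $b=b'$, and $a,a'$ agree except in positions $i\ne j$, with $c=a'_i-a_i=a_j-a'_j>0$; $\gamma=a_i+b_i+c-a_j-b_j$. The component in $\mathcal O\mathbf e_i+\mathcal O\mathbf e_j$ is generated by $x^{a_i+c}y^{b_i}\mathbf e_i$, $x^{a_j}y^{b_j}\mathbf e_j$, and $s x^{a_i}y^{b_i}\mathbf e_i+t x^{a_j-c}y^{b_j+\gamma}\mathbf e_j$ if $\gamma\ge0$, or $s x^{a_i}y^{b_i-\gamma}\mathbf e_i+t x^{a_j-c}y^{b_j}\mathbf e_j$ if $\gamma<0$. Type II, second kind: $\delta=\delta'$, $a=a'$, and $b,b'$ agree except in positions $i\neq j$, with $c=b'_i-b_i=b_j-b'_j>0$; $\gamma=a_i+b_i+c-a_j-b_j$. The component in $\mathcal O\mathbf e_i+\mathcal O\mathbf e_j$ is generated by $x^{a_i}y^{b_i+c}\mathbf e_i$, $x^{a_j}y^{b_j}\mathbf e_j$, and $s x^{a_i}y^{b_i}\mathbf e_i+t x^{a_j+\gamma}y^{b_j-c}\mathbf e_j$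 if $\gamma\ge0$, or $s x^{a_i-\gamma}y^{b_i}\mathbf e_i+t x^{a_j}y^{b_j-c}\mathbf e_j$ if $\gamma<0$. Type III: $\delta=\delta'$ and $(a,b)$, $(a',b')$ agree except in position $i$ (so $\delta_i=1$ and $a_i+b_i=a'_i+b'_i$). The component in $\mathcal O\mathbf e_i$ is generated by $(s x^{a_i}y^{b_i}+t x^{a'_i}y^{b'_i})\mathbf e_i$. The weight of a curve at a fixed point on it is the $T$-weight of its tangent line there; the correspondence of the claim is the one matching each curve's tangent line with the line spanned by the basis element. *)

(* Defs.v *)
From mathcomp Require Import all_boot all_order all_algebra generic_quotient.

Set Implicit Arguments.
Unset Strict Implicit.
Unset Printing Implicit Defensive.

Import GRing.Theory.
Local Open Scope ring_scope.

(* P^1 is covered by {y <> 0} (which contains 0) and {x <> 0} (which contains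
   infinity).  All functions live in the field k(z), z = x/y.                  *)
Inductive chart := U0 | Uinf | Uboth.

Notation ratfun k := {fraction {poly k}}.

Section ProjectiveLine.
Variable k : closedFieldType.
Local Notation K := (ratfun k).

Definition cst (c : k) : K := tofrac c%:P.
Definition zvar : K := tofrac 'X.

(* The rings k[z], k[1/z] and k[z, 1/z]. *)
Definition regular (U : chart) (f : K) : Prop :=
  match U with
  | U0 => exists p : {poly k}, f = tofrac p
  | Uinf => exists p : {poly k}, f = (map_poly cst p).[zvar^-1]
  | Uboth => exists (p : {poly k}) (N : nat), f = tofrac p / zvar ^+ N
  end.

(* Dehomogenization: a form F(x, y) of degree D is read on a chart as the
   function F(xcoord, ycoord), i.e. F/y^D on U0 and Uboth, and F/x^D on Uinf;
   on Uboth the two choices differ by a unit.                                 *)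
Definition xcoord (U : chart) : K :=
  match U with U0 => zvar | Uinf => 1 | Uboth => zvar end.
Definition ycoord (U : chart) : K :=
  match U with U0 => 1 | Uinf => zvar^-1 | Uboth => 1 end.

End ProjectiveLine.

Arguments zvar {k}.
Arguments xcoord {k} U.
Arguments ycoord {k} U.

Definition row_span (R : nzRingType) (A : R -> Prop) (m n : nat)
    (G : 'M[R]_(m, n)) (v : 'rV[R]_n) : Prop :=
  exists2 c : 'rV[R]_m, forall l, A (c 0 l) & v = c *m G.

Definition seq_span (R : nzRingType) (A : R -> Prop) (n : nat)
    (gs : seq 'rV[R]_n) (v : 'rV[R]_n) : Prop :=
  row_span A (\matrix_(l < size gs) gs`_l) v.

Section Quot.
Variables (k : closedFieldType) (n : nat).
Local Notation K := (ratfun k).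

(* A quasi-coherent subsheaf of O^n, given by its sections over the charts. *)
Definition subsheaf := chart -> 'rV[K]_n -> Prop.

Definition eq_subsheaf (S S' : subsheaf) := forall U m, S U m <-> S' U m.

(* The k-points of the quot scheme Q_d(r, n): S is locally free of rank n - r
   and degree - d.  G0 and Ginf are frames of S over the two charts, and P is
   the transition matrix; the sign is such that O(-a-b), embedded in O by
   x^a y^b, has frames z^a and z^-b and transition function z^-(a+b).         *)
Definition in_quot (d r : nat) (S : subsheaf) : Prop :=
  exists (G0 Ginf : 'M[K]_((n - r)%N, n)) (P : 'M[K]_((n - r)%N)),
    [/\ row_free G0 /\ Ginf = P *m G0,
        forall i j, regular U0 (G0 i j) /\ regular Uinf (Ginf i j),
        forall m, (S U0 m <-> row_span (regular U0) G0 m) /\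
                  (S Uinf m <-> row_span (regular Uinf) Ginf m),
        forall m, (S Uboth m <-> row_span (regular Uboth) G0 m) /\
                  (S Uboth m <-> row_span (regular Uboth) Ginf m)
      & exists2 c : k, c != 0 & \det P = cst c * zvar ^- d].

(* Homomorphisms of sheaves S -> O^n / S: a map on each chart, sending a
   section of S to a representative in O^n of its image.  Only the values on
   sections of S, modulo S, are meaningful; eq_hom is the resulting equality. *)
Definition premor := chart -> 'rV[K]_n -> 'rV[K]_n.

Definition is_hom (S : subsheaf) (phi : premor) : Prop :=
  [/\ forall U m, S U m -> forall j, regular U (phi U m 0 j),
      forall U c m m', regular U c -> S U m -> S U m' ->
        S U (phi U (c *: m + m') - (c *: phi U m + phi U m'))
    & forall U m, S U m -> S Uboth (phi Uboth m - phi U m)].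

Definition eq_hom (S : subsheaf) (phi psi : premor) : Prop :=
  forall U m, S U m -> S U (phi U m - psi U m).

Definition zero_hom : premor := fun _ _ => 0.
Definition scale_hom (u : k) (phi : premor) : premor :=
  fun U m => cst u *: phi U m.
Definition lincomb (N : nat) (c : 'I_N -> k) (v : 'I_N -> premor) : premor :=
  fun U m => \sum_l cst (c l) *: v l U m.

(* The family v, indexed by the elements of D, is a k-basis of the subspace W
   of Hom(S, O^n / S).                                                        *)
Definition is_basis (S : subsheaf) (W : premor -> Prop) (I : Type)
    (D : I -> Prop) (v : I -> premor) : Prop :=
  [/\ forall x, D x -> W (v x),
      forall (N : nat) (x : 'I_N -> I) (c : 'I_N -> k),
        injective x -> (forall l, D (x l)) ->
        eq_hom S (lincomb c (fun l => v (x l))) zero_hom ->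
        forall l, c l = 0
    & forall phi, W phi ->
        exists (N : nat) (x : 'I_N -> I) (c : 'I_N -> k),
          (forall l, D (x l)) /\ eq_hom S phi (lincomb c (fun l => v (x l)))].

(* A subsheaf of O^n on P^1 x Spec k[t]; the sections over a chart are vectors
   with entries in k(z)[t].                                                   *)
Definition tfamily := chart -> 'rV[{poly K}]_n -> Prop.

(* The restriction of a family to Spec k[t]/(t^2), i.e. the image of F in
   O^n[t]/(t^2): the pairs (m0, m1) with m0 + t m1 a section.                 *)
Definition first_order (F : tfamily) (U : chart) (m0 m1 : 'rV[K]_n) : Prop :=
  exists2 M, F U M & map_mx (coefp 0%N) M = m0 /\ map_mx (coefp 1%N) M = m1.

(* The first-order deformation of S that corresponds to phi under the
   identification of the tangent space of the quot scheme at S with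
   Hom(S, O^n / S).                                                           *)
Definition deformation (S : subsheaf) (phi : premor) (U : chart)
    (m0 m1 : 'rV[K]_n) : Prop :=
  [/\ S U m0, forall j, regular U (m1 0 j) & S U (m1 - phi U m0)].

Definition velocity (S : subsheaf) (F : tfamily) (phi : premor) : Prop :=
  is_hom S phi /\
  forall U m0 m1, first_order F U m0 m1 <-> deformation S phi U m0 m1.

Record torus := Torus { tdiag : {ffun 'I_n -> k}; tq : k }.

Definition torus_pt (g : torus) := (forall i, tdiag g i != 0) /\ tq g != 0.
Definition tinv (g : torus) :=
  Torus [ffun i => (tdiag g i)^-1] (tq g)^-1.

(* The substitution z := q z in k(z), for q <> 0. *)
Definition dilate (q : k) (f : K) : K :=
  tofrac (\n_(repr f) \Po (q *: 'X)) / tofrac (\d_(repr f) \Po (q *: 'X)).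

Definition act_vec (g : torus) (m : 'rV[K]_n) : 'rV[K]_n :=
  \row_i (cst (tdiag g i) * dilate (tq g) (m 0 i)).

Definition act_sheaf (g : torus) (S : subsheaf) : subsheaf :=
  fun U m => S U (act_vec (tinv g) m).

(* For a T-fixed S, the action on Hom(S, O^n / S). *)
Definition act_hom (g : torus) (phi : premor) : premor :=
  fun U m => act_vec g (phi U (act_vec (tinv g) m)).

(* Characters of T, written additively. *)
Definition character := ('rV[int]_n * int)%type.
Definition wt_e (i : 'I_n) : character := (delta_mx 0 i, 0).
Definition wt_f : character := (0, 1).
Definition char_val (chi : character) (g : torus) : k :=
  (\prod_i tdiag g i ^ chi.1 0 i) * tq g ^ chi.2.

Definition has_weight (S : subsheaf) (phi : premor) (chi : character) : Prop :=
  forall g, torus_pt g ->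
    eq_hom S (act_hom g phi) (scale_hom (char_val chi g) phi).

(* A T-invariant curve in Q_d(r, n) parametrized by P^1, through its values
   F s t at the points [s, t].  The quotients by the F s t have constant rank
   and degree, so they form a flat family.                                    *)
Definition T_invariant_curve (d r : nat) (F : k -> k -> subsheaf) : Prop :=
  (forall s t, (s, t) != (0, 0) -> in_quot d r (F s t)) /\
  (forall g s t, torus_pt g -> (s, t) != (0, 0) ->
    exists s' t', (s', t') != (0, 0) /\
      eq_subsheaf (act_sheaf g (F s t)) (F s' t')).

End Quot.

Arguments wt_e {n} i.
Arguments wt_f {n}.

Record triple (n : nat) := Triple {
  dl : {ffun 'I_n -> bool};
  ea : {ffun 'I_n -> nat};
  eb : {ffun 'I_n -> nat} }.

Definition in_F (d r n : nat) (p : triple n) : Prop :=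
  [/\ (\sum_i dl p i = n - r)%N,
      (\sum_i (ea p i + eb p i) = d)%N
    & forall i, ~~ dl p i -> ea p i = 0%N /\ eb p i = 0%N].

(* The curves leaving the fixed point of a given triple p.  In each case p' is
   the triple at the other end; CurveIIa is the type II curve of the first
   kind (b = b') and CurveIIb that of the second kind (a = a').               *)
Inductive curve (n : nat) :=
| CurveI (i j : 'I_n) (p' : triple n)
| CurveIIa (i j : 'I_n) (p' : triple n)
| CurveIIb (i j : 'I_n) (p' : triple n)
| CurveIII (i : 'I_n) (p' : triple n).

Definition target (n : nat) (C : curve n) : triple n :=
  match C with
  | CurveI _ _ p' | CurveIIa _ _ p' | CurveIIb _ _ p' | CurveIII _ p' => p'
  end.

Definition agree_off (n : nat) (A : pred 'I_n) (p p' : triple n) : Prop :=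
  forall l, ~~ A l ->
    [/\ dl p l = dl p' l, ea p l = ea p' l & eb p l = eb p' l].

Definition valid_curve (d r n : nat) (p : triple n) (C : curve n) : Prop :=
  in_F d r (target C) /\
  match C with
  | CurveI i j p' =>
      [/\ agree_off (pred2 i j) p p', dl p i, dl p' j, ~~ dl p j & ~~ dl p' i]
  | CurveIIa i j p' =>
      [/\ dl p = dl p', eb p = eb p', agree_off (pred2 i j) p p', i != j
        & (ea p' i)%:Z - (ea p i)%:Z = (ea p j)%:Z - (ea p' j)%:Z /\
          (ea p i < ea p' i)%N]
  | CurveIIb i j p' =>
      [/\ dl p = dl p', ea p = ea p', agree_off (pred2 i j) p p', i != j
        & (eb p' i)%:Z - (eb p i)%:Z = (eb p j)%:Z - (eb p' j)%:Z /\
          (eb p i < eb p' i)%N]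
  | CurveIII i p' =>
      [/\ dl p = dl p', agree_off (pred1 i) p p' & p <> p']
  end.

Section Generators.
Variables (n : nat) (p : triple n) (R : comNzRingType).
Local Notation "''e_' i" := (delta_mx 0 i : 'rV[R]_n)
  (at level 8, i at level 2, format "''e_' i").
Local Notation a := (ea p).
Local Notation b := (eb p).

Definition fixed_gens (A : pred 'I_n) (x y : R) : seq 'rV[R]_n :=
  [seq (x ^+ a l * y ^+ b l) *: 'e_l | l <- enum 'I_n & dl p l && A l].

(* Generators of the subsheaf of O^n on P^1 x P^1, with the coordinates
   [x, y], [s, t] specialized to elements of R.                              *)
Definition curve_gens (C : curve n) (x y s t : R) : seq 'rV[R]_n :=
  match C with
  | CurveI i j p' =>
      (s * x ^+ a i * y ^+ b i) *: 'e_i + (t * x ^+ ea p' j * y ^+ eb p' j) *: 'e_j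
      :: fixed_gens (predC (pred2 i j)) x y
  | CurveIIa i j p' =>
      let c := (ea p' i - a i)%N in
      let gamma : int := (a i + b i + c)%:Z - (a j + b j)%:Z in
      [:: (x ^+ (a i + c) * y ^+ b i) *: 'e_i,
          (x ^+ a j * y ^+ b j) *: 'e_j,
          (if 0 <= gamma then
             (s * x ^+ a i * y ^+ b i) *: 'e_i
             + (t * x ^+ (a j - c) * y ^+ (b j + `|gamma|)) *: 'e_j
           else
             (s * x ^+ a i * y ^+ (b i + `|gamma|)) *: 'e_i
             + (t * x ^+ (a j - c) * y ^+ b j) *: 'e_j)
        & fixed_gens (predC (pred2 i j)) x y]
  | CurveIIb i j p' =>
      let c := (eb p' i - b i)%N in
      let gamma : int := (a i + b i + c)%:Z - (a j + b j)%:Z in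
      [:: (x ^+ a i * y ^+ (b i + c)) *: 'e_i,
          (x ^+ a j * y ^+ b j) *: 'e_j,
          (if 0 <= gamma then
             (s * x ^+ a i * y ^+ b i) *: 'e_i
             + (t * x ^+ (a j + `|gamma|) * y ^+ (b j - c)) *: 'e_j
           else
             (s * x ^+ (a i + `|gamma|) * y ^+ b i) *: 'e_i
             + (t * x ^+ a j * y ^+ (b j - c)) *: 'e_j)
        & fixed_gens (predC (pred2 i j)) x y]
  | CurveIII i p' =>
      (s * x ^+ a i * y ^+ b i + t * x ^+ ea p' i * y ^+ eb p' i) *: 'e_i
      :: fixed_gens (predC (pred1 i)) x y
  end.

End Generators.

(* Labels of the T-basis: Bfree i j c is z^c E_ij (delta_j = 0), while
   Bzero i j c and Binf i j c (delta_j = 1) are the elements that act as zero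
   on the stalks at infinity and at 0 respectively.                           *)
Inductive basis_label (n : nat) :=
| Bfree (i j : 'I_n) (c : int)
| Bzero (i j : 'I_n) (c : nat)
| Binf (i j : 'I_n) (c : nat).

Definition row_of (n : nat) (x : basis_label n) : 'I_n :=
  match x with Bfree i _ _ | Bzero i _ _ | Binf i _ _ => i end.
Definition col_of (n : nat) (x : basis_label n) : 'I_n :=
  match x with Bfree _ j _ | Bzero _ j _ | Binf _ j _ => j end.

Section FixedPoint.
Variables (k : closedFieldType) (n : nat) (p : triple n).
Local Notation K := (ratfun k).
Local Notation a := (ea p).
Local Notation b := (eb p).

Definition fixed_sheaf : subsheaf k n :=
  fun U => seq_span (regular U) (fixed_gens p predT (xcoord U) (ycoord U)).

Definition curve_value (C : curve n) (s t : k) : subsheaf k n :=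
  fun U =>
    seq_span (regular U) (curve_gens p C (xcoord U) (ycoord U) (cst s) (cst t)).

(* The restriction of the curve to s <> 0, with coordinate t := t/s. *)
Definition curve_family (C : curve n) : tfamily k n :=
  fun U => seq_span (fun f : {poly K} => forall e, regular U f`_e)
             (curve_gens p C (xcoord U)%:P (ycoord U)%:P 1 'X).

Definition valid_label (x : basis_label n) : Prop :=
  match x with
  | Bfree i j c =>
      [/\ dl p i, ~~ dl p j, - (a i)%:Z <= c & c <= (b i)%:Z]
  | Bzero i j c => [/\ dl p i, dl p j & (1 <= c <= a j)%N]
  | Binf i j c => [/\ dl p i, dl p j & (1 <= c <= b j)%N]
  end.

Definition label_exponent (x : basis_label n) : int :=
  match x with
  | Bfree i j c => c
  | Bzero i j c => ((a j)%:Z - c%:Z) - (a i)%:Z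
  | Binf i j c => (b i)%:Z - ((b j)%:Z - c%:Z)
  end.

Definition elementary (i j : 'I_n) (e : int) (m : 'rV[K]_n) : 'rV[K]_n :=
  (m 0 i * zvar ^ e) *: delta_mx 0 j.

(* When delta_j = 1 the target is a torsion sheaf supported at 0 and infinity,
   so its sections over Uinf depend only on the stalk at infinity, those over
   U0 only on the stalk at 0, and it vanishes on Uboth.                       *)
Definition basis_vec (x : basis_label n) : premor k n :=
  let v := elementary (row_of x) (col_of x) (label_exponent x) in
  fun U m =>
    match x, U with
    | Bfree _ _ _, _ | Bzero _ _ _, U0 | Binf _ _ _, Uinf => v m
    | _, _ => 0
    end.

Definition label_weight (x : basis_label n) : character n :=
  wt_e (col_of x) - wt_e (row_of x) + wt_f *~ label_exponent x.

(* The subspace of Hom(S, O^n / S) consisting of the phi whose entry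
   S_(a_i, b_i) -> (O^n / S)_j vanishes for all (i, j) outside P, i.e. the
   direct sum of the summands .E_ij with P i j.                               *)
Definition block (P : rel 'I_n) (phi : premor k n) : Prop :=
  is_hom fixed_sheaf phi /\
  forall i j, ~~ P i j -> forall U m, fixed_sheaf U m ->
    (forall l, l != i -> m 0 l = 0) ->
    fixed_sheaf U (phi U m 0 j *: delta_mx 0 j).

(* The tangent line of C at [1, 0] is the line spanned by the basis element. *)
Definition corresponds (C : curve n) (x : basis_label n) : Prop :=
  exists (phi : premor k n) (u : k),
    [/\ velocity fixed_sheaf (curve_family C) phi, u != 0
      & eq_hom fixed_sheaf phi (scale_hom u (basis_vec x))].

Definition curve_weight (C : curve n) (chi : character n) : Prop :=
  exists phi : premor k n,
    [/\ velocity fixed_sheaf (curve_family C) phi,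
        ~ eq_hom fixed_sheaf phi (@zero_hom k n)
      & has_weight fixed_sheaf phi chi].

End FixedPoint.

Arguments fixed_sheaf k [n] p.
Arguments curve_value [k n] p C s t.
Arguments basis_vec k [n] p x.
Arguments corresponds k [n] p C x.
Arguments curve_weight k [n] p C chi.

Definition blockI (n : nat) (p : triple n) : rel 'I_n :=
  fun i j => dl p i && ~~ dl p j.
Definition blockII (n : nat) (p : triple n) : rel 'I_n :=
  fun i j => [&& dl p i, dl p j & i != j].
Definition blockIII (n : nat) (p : triple n) : rel 'I_n :=
  fun i j => [&& dl p i, dl p j & i == j].

Definition typeI (n : nat) (C : curve n) :=
  if C is CurveI _ _ _ then true else false.
Definition typeII (n : nat) (C : curve n) :=
  match C with CurveIIa _ _ _ | CurveIIb _ _ _ => true | _ => false end.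
Definition typeIII (n : nat) (C : curve n) :=
  if C is CurveIII _ _ then true else false.

Definition one_to_one (A B : Type) (P : A -> Prop) (Q : B -> Prop)
    (rho : A -> B -> Prop) : Prop :=
  (forall x, P x -> exists! y, Q y /\ rho x y) /\
  (forall y, Q y -> exists! x, P x /\ rho x y).

(* The curves of one type correspond to the direct sum of the summands .E_ij
   with P i j.                                                                *)
Definition correspond_to_block (k : closedFieldType) (d r n : nat)
    (p : triple n) (type : pred (curve n)) (P : rel 'I_n) : Prop :=
  let in_block x := valid_label p x /\ P (row_of x) (col_of x) in
  one_to_one (fun C => valid_curve d r p C /\ type C) in_block
    (corresponds k p) /\
  is_basis (fixed_sheaf k p) (block p P) in_block (basis_vec k p).

(* Main.v *)
Require Import Defs.
From HB Require Import structures.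
From mathcomp Require Import all_boot all_order all_algebra generic_quotient.
From mathcomp Require Import ring zify.

Set Implicit Arguments.
Unset Strict Implicit.
Unset Printing Implicit Defensive.

Import Order.TTheory GRing.Theory Num.Theory.
Local Open Scope ring_scope.

(** Everything reduces to monomials.  On the affine charts of the projective
    line the fixed sheaf is a direct sum of modules generated by powers of the
    local coordinate z or 1/z, and each curve has a single generator that
    moves with [s, t], with two terms s x^a y^b e_i + t x^a' y^b' e_j of equal
    degree ([pencil_balanced]).

    Points of the quot scheme.  If one generator of the fixed sheaf is replaced
    by a form of the same degree, the new generators form a frame on both
    charts and the transition matrix is diagonal, with determinant z^-d
    ([in_quot_frame]).  The value of a curve at [s, t] with s nonzero has this
    form when gamma >= 0 ([curve_value_frame]); reversing the curve exchanges
    s with t and changes the sign of gamma, so this is the only case apart from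
    the two fixed points themselves.  A torus element multiplies the two terms
    of the moving generator by constants which, the degrees being equal, do
    not depend on the chart up to a common factor; so it moves the curve
    along itself ([act_curve_value]).

    The basis.  A homomorphism from the fixed sheaf to the quotient is known
    from its values on the generators, that is, from polynomials in the two
    local coordinates for each pair (i, j).  If delta_j = 1 these polynomials
    are truncated at the order of the j-th generator, and the two charts do
    not interact, since the quotient is supported at 0 and infinity.  If
    delta_j = 0 the two charts determine each other and give a section of
    O(a_i + b_i), a polynomial of bounded degree ([hom_glue],
    [degree_bound]).  The monomials of these polynomials are the
    basis elements: this is [spanning].  Conversely each of them is detected
    by one coefficient on one chart ([independent]).

    The tangent line.  To first order in t, the family is determined by the
    base term of its moving generator and the coefficient of t, so the tangent
    vector takes the first to the second and kills the other generators
    ([velocityP]); this is a single basis element, whose label is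
    [label_of].  The exponents at the other end of the curve can be read off
    the label and conversely ([label_of_inj], [label_of_surj]), which gives
    the bijection, for all curves and for each type separately.  The weights of
    curves are therefore those of the basis elements, and these are eigenvectors
    by a direct computation ([basis_vec_weight]). *)

(** * Modules over a subring *)

(** Prop-valued, because [regular] is given by existence statements. *)
Definition subring (R : nzRingType) (A : R -> Prop) : Prop :=
  [/\ A 1, forall f g, A f -> A g -> A (f - g)
    & forall f g, A f -> A g -> A (f * g)].

Section Subrings.
Variables (R : nzRingType) (A : R -> Prop) (hA : subring A).
Lemma subring1 : A 1. Proof. by case: hA. Qed.
Lemma subringB f g : A f -> A g -> A (f - g). Proof. by case: hA => _ + _; apply. Qed.
Lemma subringM f g : A f -> A g -> A (f * g). Proof. by case: hA => _ _; apply. Qed.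
Lemma subring0 : A 0. Proof. by rewrite -(subrr 1); apply: subringB subring1 subring1. Qed.
Lemma subringN f : A f -> A (- f). Proof. by rewrite -sub0r => ?; apply: subringB subring0 _. Qed.
Lemma subringD f g : A f -> A g -> A (f + g).
Proof. by move=> Af Ag; rewrite -(opprK g); apply: subringB => //; apply: subringN. Qed.
Lemma subringX f m : A f -> A (f ^+ m).
Proof.
move=> Af; elim: m => [|m ih]; first exact: subring1.
by rewrite exprS; apply: subringM.
Qed.
Lemma subring_sum (I : Type) (r : seq I) (P : pred I) F :
  (forall i, P i -> A (F i)) -> A (\sum_(i <- r | P i) F i).
Proof. by move=> h; apply: big_ind => //; [exact: subring0|exact: subringD]. Qed.
End Subrings.

Section Spans.
Variables (R : comNzRingType) (A : R -> Prop) (hA : subring A) (n : nat).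
Implicit Types (gs : seq 'rV[R]_n) (S : 'rV[R]_n -> Prop).

Definition submodule S : Prop :=
  [/\ S 0, forall v w, S v -> S w -> S (v + w) & forall c v, A c -> S v -> S (c *: v)].

Lemma submodule_sum S (I : Type) (r : seq I) (P : pred I) F : submodule S ->
  (forall i, P i -> S (F i)) -> S (\sum_(i <- r | P i) F i).
Proof. by case=> S0 SD _ h; apply: big_ind. Qed.

Lemma row_span_submodule m (G : 'M[R]_(m, n)) : submodule (row_span A G).
Proof.
split.
- by exists 0; rewrite ?mul0mx // => l; rewrite mxE; apply: subring0.
- move=> _ _ [c hc ->] [d hd ->]; exists (c + d); last by rewrite mulmxDl.
  by move=> l; rewrite mxE; apply: subringD.
- move=> f _ Af [c hc ->]; exists (f *: c); last by rewrite scalemxAl.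
  by move=> l; rewrite mxE; apply: subringM.
Qed.

Lemma row_span_min m (G : 'M[R]_(m, n)) S : submodule S ->
  (forall l, S (row l G)) -> forall v, row_span A G v -> S v.
Proof.
move=> hS hG _ [c hc ->]; rewrite mulmx_sum_row.
by apply: submodule_sum => // l _; case: hS => _ _; apply.
Qed.

Lemma row_span_row m (G : 'M[R]_(m, n)) l : row_span A G (row l G).
Proof.
exists (delta_mx 0 l); last by rewrite -rowE.
move=> l'; rewrite mxE eqxx /=; case: eqP => _; [exact: subring1|exact: subring0].
Qed.

Lemma seq_span_submodule gs : submodule (seq_span A gs).
Proof. exact: row_span_submodule. Qed.

Lemma seq_span_min gs S : submodule S ->
  (forall g, g \in gs -> S g) -> forall v, seq_span A gs v -> S v.
Proof.
move=> hS hg; apply: row_span_min => // l.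
by rewrite rowK; apply: hg; apply: mem_nth.
Qed.

Lemma seq_span_mem gs g : g \in gs -> seq_span A gs g.
Proof.
move=> hg; have lt : (index g gs < size gs)%N by rewrite index_mem.
have := row_span_row (\matrix_(l < size gs) gs`_l) (Ordinal lt).
by rewrite rowK /= nth_index.
Qed.

Lemma seq_span_sub gs gs' : (forall g, g \in gs -> seq_span A gs' g) ->
  forall v, seq_span A gs v -> seq_span A gs' v.
Proof. by move=> h; apply: seq_span_min => //; apply: seq_span_submodule. Qed.

End Spans.

(** * The field k(z) and its dilations *)

Lemma pi_numden (R : idomainType) (x : {ratio R}) :
  (\pi_({fraction R})%qT x) * tofrac (\d_x) = tofrac (\n_x).
Proof.
unlock tofrac; rewrite -[LHS]FracField.pi_mul.
apply/eqmodP; rewrite /= FracField.equivfE /FracField.mulf.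
by rewrite !numden_Ratio ?mulf_neq0 ?mulr1 ?oner_eq0 ?denom_ratioP // mulrC.
Qed.

Lemma frac_numden (R : idomainType) (f : {fraction R}) :
  f = tofrac (\n_(repr f)) / tofrac (\d_(repr f)).
Proof.
have nz: (tofrac \d_(repr f)) != 0 by rewrite tofrac_eq0 denom_ratioP.
by apply: (mulIf nz); rewrite divfK // -pi_numden reprK.
Qed.

Section RationalFunctions.
Variable k : closedFieldType.
Local Notation K := (ratfun k).
Local Notation zvar := (@zvar k).
Local Notation cst := (@cst k).
Local Notation tofrac := (@tofrac {poly k}).

HB.instance Definition _ :=
  GRing.RMorphism.copy (@Defs.cst k) (tofrac \o polyC).

Lemma cst_eq0 (c : k) : (cst c == 0) = (c == 0).
Proof. exact: fmorph_eq0. Qed.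

Lemma cst0 : cst 0 = 0. Proof. exact: rmorph0. Qed.
Lemma cst1 : cst 1 = 1. Proof. exact: rmorph1. Qed.
Lemma cstM a b : cst (a * b) = cst a * cst b. Proof. exact: rmorphM. Qed.
Lemma cstV a : cst a^-1 = (cst a)^-1. Proof. exact: fmorphV. Qed.
Lemma cstXz a (m : int) : cst (a ^ m) = cst a ^ m. Proof. exact: fmorphXz. Qed.

Lemma zvar_neq0 : zvar != 0.
Proof. by rewrite tofrac_eq0 polyX_eq0. Qed.

Lemma tofracE (p : {poly k}) : tofrac p = (map_poly cst p).[zvar].
Proof.
have -> : map_poly cst p = map_poly tofrac (map_poly polyC p).
  by rewrite -map_poly_comp.
have -> : zvar = tofrac 'X by [].
by rewrite horner_map -/(comp_poly 'X p) comp_polyXr.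
Qed.

Lemma fracP (f : K) : exists u v : {poly k}, v != 0 /\ f = tofrac u / tofrac v.
Proof.
by exists \n_(repr f), \d_(repr f); rewrite -frac_numden denom_ratioP.
Qed.

Lemma comp_scale_eq0 (q : k) (u : {poly k}) :
  q != 0 -> (u \Po (q *: 'X) == 0) = (u == 0).
Proof.
move=> q0; apply/eqP/eqP => [h|->]; last by rewrite comp_poly0.
have: (u \Po (q *: 'X)) \Po (q^-1 *: 'X) = 0 by rewrite h comp_poly0.
rewrite -comp_polyA comp_polyZ comp_polyX scalerA mulfV // scale1r.
by rewrite comp_polyXr.
Qed.

(** Independence of the representative: two fractions that agree give the same
    cross product, and this identity survives the substitution because
    composition with [q *: 'X] is a ring morphism, injective for q nonzero.
    All algebraic properties of [dilate] follow from this formula. *)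
Lemma dilate_frac (q : k) (u v : {poly k}) : q != 0 -> v != 0 ->
  dilate q (tofrac u / tofrac v)
    = tofrac (u \Po (q *: 'X)) / tofrac (v \Po (q *: 'X)).
Proof.
move=> q0 v0; rewrite /dilate; set f := tofrac u / tofrac v.
have d0 := denom_ratioP (repr f).
have nz (w : {poly k}) : w != 0 -> (tofrac w : K) != 0 by rewrite tofrac_eq0.
apply/eqP; rewrite eqr_div ?nz ?comp_scale_eq0 // -!tofracM tofrac_eq.
rewrite -!comp_polyM; apply/eqP; congr (_ \Po _).
apply/eqP; rewrite -tofrac_eq !tofracM -eqr_div ?nz //.
by rewrite -frac_numden.
Qed.

Lemma dilate_is_zmod_morphism (q : k) : q != 0 -> zmod_morphism (dilate q).
Proof.
move=> q0 f g; have [u [v [v0 ->]]] := fracP f; have [u' [v' [v'0 ->]]] := fracP g.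
have nz (w : {poly k}) : w != 0 -> (tofrac w : K) != 0 by rewrite tofrac_eq0.
rewrite -mulNr addf_div ?nz // -tofracN -!tofracM -tofracD.
rewrite !dilate_frac ?mulf_neq0 // -mulNr addf_div ?nz ?comp_scale_eq0 //.
by rewrite comp_polyD !comp_polyM raddfN /= tofracD !tofracM tofracN.
Qed.

Lemma dilate_is_monoid_morphism (q : k) : q != 0 -> monoid_morphism (dilate q).
Proof.
move=> q0; split=> [|f g].
  rewrite -[X in dilate q X](divr1 1) -tofrac1 dilate_frac ?oner_eq0 //.
  by rewrite comp_polyC divff ?oner_eq0 // tofrac1 oner_eq0.
have [u [v [v0 ->]]] := fracP f; have [u' [v' [v'0 ->]]] := fracP g.
rewrite mulf_div -!tofracM !dilate_frac ?mulf_neq0 //.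
by rewrite !comp_polyM !tofracM mulf_div.
Qed.

Section Dilation.
Variables (q : k) (q0 : q != 0).

Lemma dilateB f g : dilate q (f - g) = dilate q f - dilate q g.
Proof. exact: (dilate_is_zmod_morphism q0 f g). Qed.
Lemma dilate0 : dilate q 0 = 0.
Proof. by have := dilateB 0 0; rewrite !subrr. Qed.
Lemma dilateD f g : dilate q (f + g) = dilate q f + dilate q g.
Proof. by rewrite -{1}(opprK g) dilateB -(sub0r g) dilateB dilate0 sub0r opprK. Qed.
Lemma dilateM f g : dilate q (f * g) = dilate q f * dilate q g.
Proof. by have [_] := dilate_is_monoid_morphism q0; apply. Qed.
Lemma dilate1 : dilate q 1 = 1.
Proof. by have [] := dilate_is_monoid_morphism q0. Qed.
Lemma dilateX f m : dilate q (f ^+ m) = dilate q f ^+ m.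
Proof.
by elim: m => [|m ih]; rewrite ?expr0 ?dilate1 // !exprS dilateM ih.
Qed.
Lemma dilateV f : dilate q f^-1 = (dilate q f)^-1.
Proof.
have [->|f0] := eqVneq f 0; first by rewrite !(invr0, dilate0).
apply: (mulIf f0); have : dilate q f * dilate q f^-1 = 1.
  by rewrite -dilateM mulfV ?dilate1.
move=> h; have nz : dilate q f != 0.
  by apply/eqP => h0; move/eqP: h; rewrite h0 mul0r eq_sym oner_eq0.
by congr (_ * _); apply: (mulfI nz); rewrite h mulfV.
Qed.
Lemma dilateXz f (m : int) : dilate q (f ^ m) = dilate q f ^ m.
Proof. by case: m => m; rewrite ?NegzE -?exprnN ?dilateV -?exprnP dilateX. Qed.
Lemma dilate_tofrac (u : {poly k}) :
  dilate q (tofrac u) = tofrac (u \Po (q *: 'X)).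
Proof.
rewrite -[X in dilate q X](divr1 (tofrac u)) -tofrac1 dilate_frac ?oner_eq0 //.
by rewrite comp_polyC tofrac1 divr1.
Qed.
Lemma dilate_cst c : dilate q (cst c) = cst c.
Proof. by rewrite dilate_tofrac comp_polyC. Qed.
Lemma dilate_zvar : dilate q zvar = cst q * zvar.
Proof. by rewrite dilate_tofrac comp_polyX -mul_polyC tofracM. Qed.
End Dilation.

Lemma dilateK (q : k) (f : K) : q != 0 -> dilate q (dilate q^-1 f) = f.
Proof.
move=> q0; have qV0 : q^-1 != 0 by rewrite invr_eq0.
have [u [v [v0 ->]]] := fracP f.
rewrite !dilate_frac ?comp_scale_eq0 //.
by rewrite -!comp_polyA comp_polyZ comp_polyX scalerA mulVf // scale1r !comp_polyXr.
Qed.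

Lemma regular_subring (U : chart) : subring (@regular k U).
Proof.
case: U; split => /=.
- by exists 1; rewrite tofrac1.
- by move=> _ _ [u ->] [v ->]; exists (u - v); rewrite tofracB.
- by move=> _ _ [u ->] [v ->]; exists (u * v); rewrite tofracM.
- by exists 1; rewrite rmorph1 hornerE.
- by move=> _ _ [u ->] [v ->]; exists (u - v); rewrite rmorphB !hornerE.
- by move=> _ _ [u ->] [v ->]; exists (u * v); rewrite rmorphM hornerM.
- by exists 1, 0; rewrite tofrac1 expr0 divr1.
- move=> _ _ [u [N ->]] [v [M ->]]; exists (u * 'X^M - v * 'X^N), (N + M)%N.
  have zX m : zvar ^+ m != 0 by rewrite expf_neq0 ?zvar_neq0.
  rewrite -mulNr addf_div ?zX // -exprD mulNr tofracB !tofracM !tofracXn.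
  by [].
- move=> _ _ [u [N ->]] [v [M ->]]; exists (u * v), (N + M)%N.
  by rewrite mulf_div -exprD tofracM.
Qed.

End RationalFunctions.

(** * Charts and monomials *)

Section Charts.
Variable k : closedFieldType.
Local Notation K := (ratfun k).
Local Notation zvar := (@zvar k).
Local Notation cst := (@cst k).
Local Notation tofrac := (@tofrac {poly k}).
Implicit Types (U : chart) (f : K).

Lemma tofracZ c (w : {poly k}) : tofrac (c *: w) = cst c * tofrac w.
Proof. by rewrite -mul_polyC tofracM. Qed.

Definition mono U (a b : nat) : K := xcoord U ^+ a * ycoord U ^+ b.

Lemma mono_neq0 U a b : mono U a b != 0.
Proof.
have z0 := zvar_neq0 k.
by case: U; rewrite /mono /= mulf_neq0 ?expf_neq0 ?invr_eq0 ?oner_eq0.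
Qed.

Lemma monoU0 a b : mono U0 a b = zvar ^ a.
Proof. by rewrite /mono /= expr1n mulr1. Qed.
Lemma monoUinf a b : mono Uinf a b = zvar ^ (- b%:Z).
Proof. by rewrite /mono /= expr1n mul1r -exprnN exprVn. Qed.
Lemma monoUboth a b : mono Uboth a b = zvar ^ a.
Proof. by rewrite /mono /= expr1n mulr1. Qed.

Lemma monoM U a b a' b' : mono U a b * mono U a' b' = mono U (a + a') (b + b').
Proof. by rewrite /mono mulrACA -!exprD. Qed.

(** A form of degree D is read on the two affine charts by functions whose
    ratio is z^D. Frames made of forms therefore have a diagonal transition
    matrix, which is how the degrees of all sheaves below are computed. *)
Lemma mono_Uinf_U0 a b : mono Uinf a b = zvar ^- (a + b) * mono U0 a b.
Proof.
rewrite monoU0 monoUinf exprnN -expfzDr ?zvar_neq0 //.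
by congr (_ ^ _); lia.
Qed.

Lemma regular_cst U c : regular U (cst c).
Proof.
case: U => /=; first by exists c%:P.
  by exists c%:P; rewrite map_polyC hornerC.
by exists c%:P, 0%N; rewrite expr0 divr1.
Qed.

Lemma regular_xcoord U : regular U (xcoord U : K).
Proof.
case: U => /=; first by exists 'X.
  by exists 1; rewrite rmorph1 hornerE.
by exists 'X, 0%N; rewrite expr0 divr1.
Qed.

Lemma regular_ycoord U : regular U (ycoord U : K).
Proof.
case: U => /=; first by exists 1; rewrite tofrac1.
  by exists 'X; rewrite map_polyX hornerX.
by exists 1, 0%N; rewrite expr0 divr1 tofrac1.
Qed.

Lemma regular_mono U a b : regular U (mono U a b).
Proof.
have h := regular_subring k U.
by apply: (subringM h); apply: (subringX h); [exact: regular_xcoord|exact: regular_ycoord].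
Qed.

Lemma regular_zvarz (m : int) : regular Uboth (zvar ^ m).
Proof.
case: m => m /=; first by exists ('X^m), 0%N; rewrite expr0 divr1 tofracXn.
by exists 1, m.+1; rewrite NegzE -exprnN tofrac1 mul1r.
Qed.

Lemma regular_Uboth U f : regular U f -> regular Uboth f.
Proof.
have h := regular_subring k Uboth.
case: U => //= -[u ->]; first by exists u, 0%N; rewrite expr0 divr1.
rewrite (horner_coef_wide _ (size_poly _ _)).
apply: (subring_sum h) => l _; apply: (subringM h).
  by rewrite coef_map; apply: regular_cst.
by apply: (subringX h); exact: (regular_zvarz (-1)).
Qed.

Lemma regular_dilate U (q : k) f : q != 0 -> regular U f -> regular U (dilate q f).
Proof.
move=> q0; case: U => /=.
- by case=> u ->; exists (u \Po (q *: 'X)); rewrite dilate_tofrac.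
- case=> u ->; rewrite (horner_coef_wide _ (size_poly _ _)).
  have h := regular_subring k Uinf.
  have dsum : {morph dilate q : f g / f + g} := dilateD q0.
  rewrite (big_morph _ dsum (dilate0 q0)).
  apply: (subring_sum h) => l _; rewrite dilateM // dilateX // dilateV //.
  rewrite coef_map dilate_cst // dilate_zvar //.
  apply: (subringM h); first exact: regular_cst.
  apply: (subringX h); rewrite invfM -fmorphV.
  apply: (subringM h); first exact: regular_cst.
  exact: (regular_ycoord Uinf).
- case=> u [N ->]; exists ((q^-1 ^+ N) *: (u \Po (q *: 'X))), N.
  rewrite dilateM // dilateV // dilateX // dilate_zvar // dilate_tofrac //.
  by rewrite tofracZ rmorphXn exprMn fmorphV invfM exprVn; ring.
Qed.

(** The constant by which the dilation scales the coordinate y on a chart; x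
    is scaled by q times this constant. *)
Definition yscale U (q : k) : k := if U is Uinf then q^-1 else 1.

(** The only factor that depends on the chart is governed by the degree a + b,
    so it is common to all monomials of one degree and disappears from spans
    of forms. *)
Lemma dilate_mono U (q : k) a b : q != 0 ->
  dilate q (mono U a b) = cst (yscale U q ^+ (a + b) * q ^+ a) * mono U a b.
Proof.
move=> q0; rewrite /mono dilateM // !dilateX //; case: U => /=.
- rewrite dilate_zvar // dilate1 // exprMn rmorphM !rmorphXn rmorph1 !expr1n /=; ring.
- rewrite dilate1 // dilateV // dilate_zvar // invfM exprMn !expr1n !mul1r.
  congr (_ * _); rewrite exprVn -rmorphXn -fmorphV /=; congr (cst _).
  by rewrite exprVn exprD invfM mulrAC mulVf ?mul1r ?expf_neq0.
- rewrite dilate_zvar // dilate1 // exprMn rmorphM !rmorphXn rmorph1 !expr1n /=; ring.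
Qed.

End Charts.

(** * The fixed sheaf, coordinate by coordinate *)

Section FixedSheaf.
Variables (k : closedFieldType) (n : nat).
Local Notation K := (ratfun k).
Local Notation zvar := (@zvar k).
Local Notation cst := (@cst k).
Implicit Types (U : chart) (f : K) (p : triple n).
Local Notation "''e_' i" := (delta_mx 0 i : 'rV_n)
  (at level 8, i at level 2, format "''e_' i").

(** The fixed sheaf is the direct sum of its components, so that membership is
    decided one coordinate at a time. *)
Definition component p U l f : Prop :=
  exists2 g, regular U g & f = if dl p l then g * mono k U (ea p l) (eb p l) else 0.

Lemma component_submodule p U l :
  [/\ component p U l 0,
      forall f g, component p U l f -> component p U l g -> component p U l (f + g)
    & forall c f, regular U c -> component p U l f -> component p U l (c * f)].
Proof.
have h := regular_subring k U; split.
- by exists 0; [exact: subring0 h|rewrite mul0r; case: ifP].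
- move=> _ _ [f hf ->] [g hg ->]; exists (f + g); first exact: subringD.
  by case: ifP; rewrite ?addr0 // mulrDl.
- move=> c _ hc [f hf ->]; exists (c * f); first exact: subringM.
  by case: ifP; rewrite ?mulr0 // mulrA.
Qed.

Lemma component_sub p U l f : component p U l f -> regular U f.
Proof.
have h := regular_subring k U; case=> g hg ->.
by case: ifP => _; [apply: subringM => //; exact: regular_mono|exact: subring0].
Qed.

(** On the overlap of the charts x and y are units, so x^a y^b generates
    everything. *)
Lemma component_Uboth p l f : dl p l -> regular Uboth f -> component p Uboth l f.
Proof.
move=> dlp hf; exists (f / mono k Uboth (ea p l) (eb p l)).
  apply: subringM => //; first exact: regular_subring.
  by rewrite monoUboth invr_expz; exact: regular_zvarz.
by rewrite dlp divfK ?mono_neq0.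
Qed.

Lemma component_mono p U l a b : dl p l -> (ea p l <= a)%N -> (eb p l <= b)%N ->
  component p U l (mono k U a b).
Proof.
move=> dlp la lb; exists (mono k U (a - ea p l) (b - eb p l)).
  exact: regular_mono.
by rewrite dlp monoM !subnK.
Qed.

Lemma fixed_sheafP p U (m : 'rV[K]_n) :
  fixed_sheaf k p U m <-> forall l, component p U l (m 0 l).
Proof.
have hR := regular_subring k U; split.
  apply: (seq_span_min (S := fun v => forall l, component p U l (v 0 l))); first split.
  - by move=> l; rewrite mxE; case: (component_submodule p U l).
  - by move=> v w hv hw l; rewrite mxE; case: (component_submodule p U l) => _ + _; apply.
  - by move=> c v hc hv l; rewrite mxE; case: (component_submodule p U l) => _ _; apply.
  move=> g /mapP [i]; rewrite mem_filter => /andP[/andP[dli _] _] -> l.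
  rewrite !mxE eqxx /=; case: eqP => [->|_]; rewrite ?mulr1 ?mulr0.
    by exists 1; [exact: subring1 hR|rewrite dli mul1r].
  by case: (component_submodule p U l).
move=> h; rewrite (row_sum_delta m).
apply: submodule_sum => [|l _]; first exact: seq_span_submodule.
have [g hg ->] := h l; case: ifP => dll.
  have [_ _ hZ] := seq_span_submodule hR (fixed_gens p predT (xcoord U) (ycoord U)).
  rewrite -scalerA; apply: hZ => //; apply: seq_span_mem => //.
  by apply/mapP; exists l; rewrite // mem_filter dll mem_enum.
by rewrite scale0r; have [] := seq_span_submodule hR (fixed_gens p predT (xcoord U) (ycoord U)).
Qed.

Lemma fixed_sheaf_submodule p U : submodule (regular U) (fixed_sheaf k p U).
Proof. exact/seq_span_submodule/regular_subring. Qed.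

Lemma fixed_sheafB p U m m' :
  fixed_sheaf k p U m -> fixed_sheaf k p U m' -> fixed_sheaf k p U (m - m').
Proof.
have [_ hD hZ] := fixed_sheaf_submodule p U => hm hm'; apply: hD => //.
rewrite -scaleN1r; apply: hZ => //; apply: subringN (regular_subring k U) _ _.
exact: subring1 (regular_subring k U).
Qed.

Lemma fixed_sheaf_delta p U l f :
  component p U l f -> fixed_sheaf k p U (f *: 'e_l).
Proof.
move=> hf; apply/fixed_sheafP => l'; rewrite !mxE eqxx /=.
case: eqP => [->|_]; rewrite ?mulr1 ?mulr0 //.
by case: (component_submodule p U l').
Qed.

End FixedSheaf.

(** * Points of the quot scheme from homogeneous frames *)

Lemma seq_span_size (R : comNzRingType) (A : R -> Prop) (n m : nat) (gs : seq 'rV[R]_n) w :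
  size gs = m -> seq_span A gs w <-> row_span A (\matrix_(l < m) gs`_l) w.
Proof. by move=> <-. Qed.

Section Frames.
Variables (k : closedFieldType) (n : nat).
Local Notation K := (ratfun k).
Local Notation zvar := (@zvar k).
Local Notation cst := (@cst k).
Implicit Types (U : chart) (f : K) (p : triple n).
Local Notation "''e_' i" := (delta_mx 0 i : 'rV_n)
  (at level 8, i at level 2, format "''e_' i").

Lemma eq_subsheaf_sym (S S' : subsheaf k n) : eq_subsheaf S S' -> eq_subsheaf S' S.
Proof. by move=> h U m; split=> /h. Qed.

Lemma eq_subsheaf_trans (S S' S'' : subsheaf k n) :
  eq_subsheaf S S' -> eq_subsheaf S' S'' -> eq_subsheaf S S''.
Proof. by move=> h h' U m; split=> [/h /h'|/h' /h]. Qed.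

Lemma in_quot_eq d r (S S' : subsheaf k n) :
  eq_subsheaf S S' -> in_quot d r S -> in_quot d r S'.
Proof.
move=> h [G0 [Ginf [P [hf hr h1 h2 hd]]]]; exists G0, Ginf, P; split=> // m.
  by have [e1 e2] := h1 m; split; [rewrite -e1|rewrite -e2]; split=> /h.
by have [e1 e2] := h2 m; split; [rewrite -e1|rewrite -e2]; split=> /h.
Qed.

(** The fixed sheaf with its i-th generator replaced by v. *)
Definition frame_sheaf p (i : 'I_n) (v : chart -> 'rV[K]_n) : subsheaf k n :=
  fun U => seq_span (regular U)
    (v U :: fixed_gens p (predC1 i) (xcoord U) (ycoord U)).

Section HomogeneousFrame.
Variables (d r : nat) (p : triple n) (hp : in_F d r p) (i : 'I_n) (dli : dl p i).
Variable v : chart -> 'rV[K]_n.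
Hypothesis v_both : v Uboth = v U0.
Hypothesis v_inf : v Uinf = zvar ^- (ea p i + eb p i) *: v U0.
Hypothesis v_reg : forall U l, regular U (v U 0 l).
Hypothesis v_piv : v U0 0 i != 0.

Local Notation L := [seq l <- enum 'I_n | dl p l && predC1 i l].
Local Notation gs U := (v U :: fixed_gens p (predC1 i) (xcoord U) (ycoord U)).

Let degs := ((ea p i + eb p i) :: [seq ea p l + eb p l | l <- L])%N.

Lemma size_frame U : size (gs U) = (n - r)%N.
Proof.
have [<- _ _] := hp; rewrite /= size_map.
rewrite (bigD1 i) //= dli add1n -sum1_size big_filter big_enum_cond /=.
congr _.+1; rewrite big_mkcondr [in RHS]big_mkcond [in LHS]big_mkcond /=.
by apply: eq_bigr => l _; case: (dl p l); case: (l != i).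
Qed.

Lemma sum_degs : (\sum_(D <- degs) D)%N = d.
Proof.
have [_ <- h0] := hp; rewrite big_cons big_map big_filter big_enum_cond /=.
rewrite [in RHS](bigD1 i) //=; congr (_ + _)%N.
rewrite big_mkcondr [in RHS]big_mkcond [in LHS]big_mkcond /=.
apply: eq_bigr => l _; have := h0 l; case: (dl p l) => //=.
by case=> // -> ->; case: ifP.
Qed.

Lemma row_frame_inf l : (l < n - r)%N ->
  (gs Uinf)`_l = zvar ^- (nth 0%N degs l) *: (gs U0)`_l.
Proof.
rewrite -(size_frame U0) /= size_map ltnS => hl.
case: l hl => [|l] hl //=.
rewrite !(nth_map i) // scalerA; congr (_ *: _).
exact: mono_Uinf_U0.
Qed.

(** Column i sees only v, since the other generators are multiples of the e_l
    with l distinct from i; so the coefficient of v in a relation vanishes,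
    and then each remaining column isolates one remaining coefficient. *)
Lemma frame_free : row_free (\matrix_(l < n - r) (gs U0)`_l).
Proof.
rewrite -(size_frame U0) /= size_map.
apply: inj_row_free => c hc.
have colE j : \sum_l c 0 l * (gs U0)`_l 0 j = 0.
  by have /matrixP/(_ 0 j) := hc; rewrite !mxE => h; rewrite -[RHS]h;
     apply: eq_bigr => l _; rewrite !mxE.
have tail j (l : 'I_(size L)) : (gs U0)`_(lift ord0 l) 0 j
    = mono k U0 (ea p (nth i L l)) (eb p (nth i L l)) * (nth i L l == j)%:R.
  rewrite lift0 [LHS](_ : _ = (fixed_gens p (predC1 i) (xcoord U0) (ycoord U0))`_l 0 j) //.
  by rewrite (nth_map i) // !mxE eqxx eq_sym.
have nthL (l : 'I_(size L)) : nth i L l != i.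
  by have := mem_nth i (ltn_ord l); rewrite mem_filter => /andP[/andP[]].
have c0 : c 0 ord0 = 0.
  have := colE i; rewrite big_ord_recl big1 => [|l _].
    by move/eqP; rewrite addr0 mulf_eq0 (negPf v_piv) orbF => /eqP.
  by rewrite tail (negPf (nthL l)) !mulr0.
apply/rowP => l; rewrite mxE; have [l' ->|-> //] := unliftP ord0 l.
have := colE (nth i L l'); rewrite big_ord_recl c0 mul0r add0r (bigD1 l') //=.
rewrite big1 => [|l2 ne].
  rewrite tail eqxx mulr1 addr0 => /eqP; rewrite mulf_eq0 (negPf (mono_neq0 _ _ _ _)).
  by rewrite orbF => /eqP.
rewrite tail nth_uniq //; last exact/filter_uniq/enum_uniq.
by rewrite (inj_eq val_inj) (negPf ne) !mulr0.
Qed.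

(** If v is homogeneous of the degree a_i + b_i of the generator that it
    replaces, the same vectors form a frame on both charts and the transition
    matrix is diagonal with entries z^-(a_l + b_l); its determinant is z^-d.
    *)
Lemma in_quot_frame : in_quot d r (frame_sheaf p i v).
Proof.
pose G U := \matrix_(l < n - r) (gs U)`_l.
pose dg : 'rV[K]_(n - r) := \row_l zvar ^- (nth 0%N degs l).
exists (G U0), (G Uinf), (diag_mx dg); split.
- split; first exact: frame_free.
  apply/row_matrixP => l; rewrite row_mul row_diag_mx -scalemxAl -rowE !rowK mxE.
  exact: row_frame_inf.
- have gs_reg U (l : 'I_(n - r)) j : regular U ((gs U)`_l 0 j).
    have : (gs U)`_l \in gs U by rewrite mem_nth // size_frame.
    rewrite inE => /orP[/eqP -> //|/mapP [l' _ ->]].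
    rewrite !mxE; apply: subringM; first exact: regular_subring.
      exact: regular_mono.
    have h := regular_subring k U.
    by case: (_ && _); [exact: subring1|exact: subring0].
  by move=> l j; rewrite !mxE; split; apply: gs_reg.
- by move=> m; split; apply: seq_span_size; rewrite size_frame.
- have hR := regular_subring k Uboth.
  have e0 m : frame_sheaf p i v Uboth m <-> row_span (regular Uboth) (G U0) m.
    by rewrite -seq_span_size ?size_frame // /frame_sheaf v_both.
  (* On the overlap the two frames differ by powers of z, which are units. *)
  have zDV (D : nat) : zvar ^ D * zvar ^- D = 1.
    by apply: mulfV; rewrite expf_neq0 ?zvar_neq0.
  move=> m; split; first exact: e0.
  rewrite e0; split; apply: row_span_min; try exact: row_span_submodule.
  + move=> l; have := row_span_row hR (G Uinf) l; rewrite !rowK row_frame_inf // => h.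
    have [_ _ hZ] := row_span_submodule hR (G Uinf).
    have := hZ _ _ (regular_zvarz k (nth 0%N degs l)) h.
    by rewrite scalerA zDV scale1r.
  + move=> l; have := row_span_row hR (G U0) l; rewrite !rowK row_frame_inf // => h.
    have [_ _ hZ] := row_span_submodule hR (G U0); apply: hZ => //.
    by rewrite exprnN; apply: regular_zvarz.
- exists 1; first exact: oner_neq0.
  rewrite det_diag rmorph1 mul1r -sum_degs.
  have sz : size degs = (n - r)%N by rewrite -(size_frame U0) /= !size_map.
  rewrite (big_nth 0%N) sz big_mkord.
  apply: (big_ind2 (fun f D => f = zvar ^- D)) => [|_ D _ D' -> ->|l _].
  + by rewrite expr0 invr1.
  + by rewrite exprD invfM.
  + by rewrite mxE.
Qed.

End HomogeneousFrame.
End Frames.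

(** * The generators of a curve *)

(** The moving generator s x^a y^b e_i + t x^a' y^b' e_j of a curve. For type
    III the two indices coincide. *)
Record pencil n := Pencil {
  pc_i : 'I_n; pc_a : nat; pc_b : nat;
  pc_j : 'I_n; pc_a' : nat; pc_b' : nat }.

Definition monomial n := ('I_n * nat * nat)%type.

Section Combinatorics.
Variable n : nat.
Implicit Types (p : triple n) (C : curve n).

(** The integer gamma of type II. It is set to zero for types I and III, whose
    values have the same shape as those of type II with gamma >= 0. *)
Definition curve_gap p C : int :=
  match C with
  | CurveIIa i j p' =>
      (ea p i + eb p i + (ea p' i - ea p i))%:Z - (ea p j + eb p j)%:Z
  | CurveIIb i j p' =>
      (ea p i + eb p i + (eb p' i - eb p i))%:Z - (ea p j + eb p j)%:Z
  | _ => 0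
  end.

Definition curve_pencil p C : pencil n :=
  match C with
  | CurveI i j p' => Pencil i (ea p i) (eb p i) j (ea p' j) (eb p' j)
  | CurveIIa i j p' =>
      let c := (ea p' i - ea p i)%N in
      if 0 <= curve_gap p C
      then Pencil i (ea p i) (eb p i) j (ea p j - c) (eb p j + `|curve_gap p C|)
      else Pencil i (ea p i) (eb p i + `|curve_gap p C|) j (ea p j - c) (eb p j)
  | CurveIIb i j p' =>
      let c := (eb p' i - eb p i)%N in
      if 0 <= curve_gap p C
      then Pencil i (ea p i) (eb p i) j (ea p j + `|curve_gap p C|) (eb p j - c)
      else Pencil i (ea p i + `|curve_gap p C|) (eb p i) j (ea p j) (eb p j - c)
  | CurveIII i p' => Pencil i (ea p i) (eb p i) i (ea p' i) (eb p' i)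
  end.

Definition curve_off C : pred 'I_n :=
  match C with
  | CurveI i j _ | CurveIIa i j _ | CurveIIb i j _ => predC (pred2 i j)
  | CurveIII i _ => predC (pred1 i)
  end.

(** The generators that do not depend on [s, t]. *)
Definition curve_monos p C : seq (monomial n) :=
  match C with
  | CurveIIa i j p' =>
      [:: (i, ea p i + (ea p' i - ea p i), eb p i); (j, ea p j, eb p j)]%N
  | CurveIIb i j p' =>
      [:: (i, ea p i, eb p i + (eb p' i - eb p i)); (j, ea p j, eb p j)]%N
  | _ => [::]
  end ++ [seq (l, ea p l, eb p l) | l <- enum 'I_n & dl p l && curve_off C l].

(** The same curve seen from its other end. This exchanges s with t and
    changes the sign of gamma, so that gamma >= 0 may be assumed when both s
    and t are nonzero, and the statement at [0, 1] follows from the one at [1,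
    0]. *)
Definition rev_curve p C : curve n :=
  match C with
  | CurveI i j _ => CurveI j i p
  | CurveIIa i j _ => CurveIIa j i p
  | CurveIIb i j _ => CurveIIb j i p
  | CurveIII i _ => CurveIII i p
  end.

Lemma sum_agree_off (f g : 'I_n -> nat) (A : pred 'I_n) :
  (forall l, ~~ A l -> f l = g l) -> (\sum_l f l = \sum_l g l)%N ->
  (\sum_(l | A l) f l = \sum_(l | A l) g l)%N.
Proof.
move=> h; rewrite (bigID A) [in RHS](bigID A) /=.
by rewrite [X in (_ + X)%N](eq_bigr g h) => /addIn.
Qed.

Lemma sum_pred2 (f : 'I_n -> nat) i j : i != j ->
  (\sum_(l | pred2 i j l) f l = f i + f j)%N.
Proof.
move=> ij; rewrite (bigD1 i) /= ?eqxx // (bigD1 j) /=; last by rewrite eqxx orbT eq_sym.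
rewrite big1 ?addn0 // => l; by case/andP=> /andP[/orP[] ->].
Qed.

Lemma degree_pred2 d r p p' i j : in_F d r p -> in_F d r p' ->
  agree_off (pred2 i j) p p' -> i != j ->
  (ea p i + eb p i + (ea p j + eb p j) = ea p' i + eb p' i + (ea p' j + eb p' j))%N.
Proof.
move=> [_ h _] [_ h' _] hA ij.
rewrite -!(sum_pred2 (fun l => ea _ l + eb _ l)%N ij).
apply: sum_agree_off; last by rewrite h h'.
by move=> l /hA [_ -> ->].
Qed.

Lemma degree_pred1 d r p p' i : in_F d r p -> in_F d r p' ->
  agree_off (pred1 i) p p' -> (ea p i + eb p i = ea p' i + eb p' i)%N.
Proof.
move=> [_ h _] [_ h' _] hA.
have := @sum_agree_off (fun l => ea p l + eb p l)%N (fun l => ea p' l + eb p' l)%N (pred1 i).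
rewrite !big_pred1_eq; apply; last by rewrite h h'.
by move=> l /hA [_ -> ->].
Qed.

Lemma triple_ext p p' : (forall l, [/\ dl p l = dl p' l, ea p l = ea p' l & eb p l = eb p' l]) ->
  p = p'.
Proof.
case: p p' => [d1 a1 b1] [d2 a2 b2] /= h.
by congr Triple; apply/ffunP => l; have [] := h l.
Qed.

(** Validity together with what the membership of both triples in F adds to
    it: which delta vanish, and the balance of degrees that the equality of
    the two total degrees forces on the modified positions. *)
Variant valid_spec d r p : curve n -> Prop :=
| ValidI i j p' of in_F d r p' & agree_off (pred2 i j) p p' & i != j & dl p i & dl p' j
   & ~~ dl p j & ~~ dl p' i & [/\ ea p j = 0%N, eb p j = 0%N, ea p' i = 0%N & eb p' i = 0%N]
   & (ea p i + eb p i = ea p' j + eb p' j)%N : valid_spec d r p (CurveI i j p')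
| ValidIIa i j p' of in_F d r p' & agree_off (pred2 i j) p p' & i != j & dl p i & dl p j
   & dl p = dl p' & eb p = eb p' & (ea p i < ea p' i)%N
   & (ea p i + ea p j = ea p' i + ea p' j)%N : valid_spec d r p (CurveIIa i j p')
| ValidIIb i j p' of in_F d r p' & agree_off (pred2 i j) p p' & i != j & dl p i & dl p j
   & dl p = dl p' & ea p = ea p' & (eb p i < eb p' i)%N
   & (eb p i + eb p j = eb p' i + eb p' j)%N : valid_spec d r p (CurveIIb i j p')
| ValidIII i p' of in_F d r p' & agree_off (pred1 i) p p' & dl p i & dl p = dl p'
   & ea p i != ea p' i & (ea p i + eb p i = ea p' i + eb p' i)%N :
   valid_spec d r p (CurveIII i p').

Lemma valid_curveP d r p C : in_F d r p -> valid_curve d r p C -> valid_spec d r p C.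
Proof.
move=> hp; have [_ _ z0] := hp;
  case: C => [i j p'|i j p'|i j p'|i p']; rewrite /valid_curve /= => -[hp'];
  have [_ _ z0'] := hp'.
- case=> hA di dj' dj di'; have ij : i != j by apply: contraNneq dj => <-.
  have [aj bj] := z0 _ dj; have [ai bi] := z0' _ di'.
  have e := degree_pred2 hp hp' hA ij.
  by apply: ValidI => //; move: e; rewrite aj bj ai bi; lia.
- case=> ed eb hA ij [ec lt].
  have di : dl p i by apply: contraLR lt => di; have [|-> _] := z0' i; rewrite -?ed.
  have dj : dl p j by apply: contraLR lt => /z0[]; lia.
  by constructor=> //; lia.
- case=> ed eb hA ij [ec lt].
  have di : dl p i by apply: contraLR lt => di; have [|_ ->] := z0' i; rewrite -?ed.
  have dj : dl p j by apply: contraLR lt => /z0[]; lia.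
  by constructor=> //; lia.
- case=> ed hA ne; have e := degree_pred1 hp hp' hA.
  have na : ea p i != ea p' i.
    apply/eqP => ea_eq; apply: ne; apply: triple_ext => l.
    have [->|li] := eqVneq l i; last exact: hA.
    by split=> //; [rewrite ed|lia].
  have di : dl p i.
    apply: contraNT na => di; have [-> _] := z0 _ di.
    by have [|-> _] := z0' i; rewrite -?ed.
  by constructor.
Qed.

Lemma agree_off_sym (A A' : pred 'I_n) p p' : A =1 A' ->
  agree_off A p p' -> agree_off A' p' p.
Proof. by move=> e h l; rewrite -e => /h [-> -> ->]. Qed.

Lemma pred2C (i j : 'I_n) : pred2 i j =1 pred2 j i.
Proof. by move=> l /=; rewrite orbC. Qed.

Lemma valid_rev d r p C : in_F d r p -> valid_curve d r p C ->
  valid_curve d r (target C) (rev_curve p C).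
Proof.
move=> hp /(valid_curveP hp) [] {C}.
- move=> i j p' hp' hA ij di dj' dj di' _ _; split=> //=.
  by split=> //; exact: agree_off_sym (pred2C i j) hA.
- move=> i j p' hp' hA ij di dj ed eb lt e; split=> //=.
  split=> //; [exact: agree_off_sym (pred2C i j) hA|by rewrite eq_sym|].
  by split; lia.
- move=> i j p' hp' hA ij di dj ed eb lt e; split=> //=.
  split=> //; [exact: agree_off_sym (pred2C i j) hA|by rewrite eq_sym|].
  by split; lia.
- move=> i p' hp' hA di ed na e; split=> //=.
  split=> //; first exact: agree_off_sym hA.
  by move=> ee; rewrite ee eqxx in na.
Qed.

Lemma curve_gap_rev d r p C : in_F d r p -> valid_curve d r p C ->
  curve_gap (target C) (rev_curve p C) = - curve_gap p C.
Proof.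
move=> hp /(valid_curveP hp) [] {C} //= i j p' _ _ _ _ _ _ <- lt e; lia.
Qed.

(** In type II this is the reason for the exponent gamma: it makes the moving
    generator homogeneous. For the other types it is the equality of total
    degrees. *)
Lemma pencil_balanced d r p C : in_F d r p -> valid_curve d r p C ->
  let h := curve_pencil p C in (pc_a h + pc_b h = pc_a' h + pc_b' h)%N.
Proof.
move=> hp /(valid_curveP hp) [] {C} //= i j p' _ _ _ _ _ _ _ lt e; case: ifP => /=; lia.
Qed.

Lemma curve_monosP d r p C m : in_F d r p -> valid_curve d r p C ->
  m \in curve_monos p C -> [/\ dl p m.1.1, (ea p m.1.1 <= m.1.2)%N & (eb p m.1.1 <= m.2)%N].
Proof.
move=> hp /(valid_curveP hp) hC; rewrite mem_cat => /orP[|/mapP[l]]; last first.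
  by rewrite mem_filter => /andP[/andP[? _] _] ->.
case: hC => {C} //= i j p' _ _ _ di dj _ _ lt e; rewrite !inE => /orP[] /eqP -> /=;
  split=> //; lia.
Qed.

Section Vectors.
Variable R : comNzRingType.
Implicit Types x y s t : R.
Local Notation "''e_' i" := (delta_mx 0 i : 'rV[R]_n)
  (at level 8, i at level 2, format "''e_' i").

Definition mono_vec x y (m : monomial n) : 'rV[R]_n :=
  (x ^+ m.1.2 * y ^+ m.2) *: 'e_m.1.1.

Definition pencil_vec (h : pencil n) x y s t : 'rV[R]_n :=
  (s * x ^+ pc_a h * y ^+ pc_b h) *: 'e_(pc_i h)
  + (t * x ^+ pc_a' h * y ^+ pc_b' h) *: 'e_(pc_j h).

Lemma fixed_gensE p A x y : fixed_gens p A x y =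
  map (mono_vec x y) [seq (l, ea p l, eb p l) | l <- enum 'I_n & dl p l && A l].
Proof. by rewrite -map_comp. Qed.

Lemma mem_curve_gens p C x y s t :
  curve_gens p C x y s t =i
  pencil_vec (curve_pencil p C) x y s t :: map (mono_vec x y) (curve_monos p C).
Proof.
move=> v; case: C => [i j p'|i j p'|i j p'|i p'] /=; rewrite ?map_cat -fixed_gensE //=.
- by rewrite !inE; case: ifP => _; rewrite [RHS]orbCA; congr orb; rewrite [RHS]orbCA.
- by rewrite !inE; case: ifP => _; rewrite [RHS]orbCA; congr orb; rewrite [RHS]orbCA.
- by rewrite /pencil_vec /= scalerDl.
Qed.

Lemma eq_fixed_gens p p' A x y : agree_off (predC A) p p' ->
  fixed_gens p A x y = fixed_gens p' A x y.
Proof.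
move=> h; rewrite /fixed_gens.
have -> : [seq l <- enum 'I_n | dl p l && A l] = [seq l <- enum 'I_n | dl p' l && A l].
  apply: eq_filter => l; case Al: (A l); rewrite ?andbF // !andbT.
  by have [|-> _ _] := h l; rewrite //= Al.
apply/eq_in_map => l; rewrite mem_filter => /andP[/andP[_ Al] _].
by have [|_ -> ->] := h l; rewrite //= Al.
Qed.

Lemma eq_pred_fixed_gens p A A' x y : (forall l, dl p l -> A l = A' l) ->
  fixed_gens p A x y = fixed_gens p A' x y.
Proof.
move=> h; rewrite /fixed_gens; congr map; apply: eq_filter => l.
by case dl_l : (dl p l) => //=; apply: h.
Qed.

Lemma fixed_gens_rev p p' i j x y : agree_off (pred2 i j) p p' ->
  fixed_gens p' (predC (pred2 j i)) x y = fixed_gens p (predC (pred2 i j)) x y.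
Proof.
move=> hA; rewrite (@eq_fixed_gens p' p).
  by apply: eq_pred_fixed_gens => l _ /=; rewrite orbC.
by apply: agree_off_sym hA => l /=; rewrite negbK orbC.
Qed.

(** In type II the first two generators are exchanged and gamma changes sign;
    for gamma = 0 both ends use the nonnegative branch, and the two formulas
    agree because the correcting power is trivial. *)
Lemma curve_gens_rev d r p C x y s t : in_F d r p -> valid_curve d r p C ->
  curve_gens (target C) (rev_curve p C) x y t s =i curve_gens p C x y s t.
Proof.
move=> hp hv v; have hg := curve_gap_rev hp hv.
case/(valid_curveP hp): hv hg => {C}.
- move=> i j p' hp' hA ij di dj' dj di' _ _ _; rewrite /= addrC inE [in RHS]inE.
  congr (_ || (v \in _)); exact: fixed_gens_rev hA.
- move=> i j p' hp' hA ij di dj ed eb lt e; rewrite /= eb.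
  have -> : (ea p j - ea p' j = ea p' i - ea p i)%N by lia.
  set c := (ea p' i - ea p i)%N => hg; rewrite hg (fixed_gens_rev x y hA).
  have -> : (ea p' j + c = ea p j)%N by lia.
  have -> : (ea p' i - c = ea p i)%N by lia.
  have -> : (ea p i + c = ea p' i)%N by lia.
  have -> : (ea p j - c = ea p' j)%N by lia.
  rewrite !inE orbCA; congr [|| _, _, v == _ | _].
  by rewrite oppr_ge0 abszN; case: ltrgt0P => [_|_|->]; rewrite ?addn0 addrC.
- move=> i j p' hp' hA ij di dj ed ea lt e; rewrite /= ea.
  have -> : (eb p j - eb p' j = eb p' i - eb p i)%N by lia.
  set c := (eb p' i - eb p i)%N => hg; rewrite hg (fixed_gens_rev x y hA).
  have -> : (eb p' j + c = eb p j)%N by lia.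
  have -> : (eb p' i - c = eb p i)%N by lia.
  have -> : (eb p i + c = eb p' i)%N by lia.
  have -> : (eb p j - c = eb p' j)%N by lia.
  rewrite !inE orbCA; congr [|| _, _, v == _ | _].
  by rewrite oppr_ge0 abszN; case: ltrgt0P => [_|_|->]; rewrite ?addn0 addrC.
- move=> i p' hp' hA di ed na e; rewrite /= addrC !inE => _.
  congr (_ || (v \in _)); apply: eq_fixed_gens.
  by apply: agree_off_sym hA => l /=; rewrite negbK.
Qed.

End Vectors.
End Combinatorics.

(** * The values of a curve *)

Section CurveSheaves.
Variables (k : closedFieldType) (n : nat).
Local Notation K := (ratfun k).
Local Notation zvar := (@zvar k).
Local Notation cst := (@cst k).
Implicit Types (U : chart) (f : K) (p : triple n) (C : curve n).
Local Notation "''e_' i" := (delta_mx 0 i : 'rV_n)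
  (at level 8, i at level 2, format "''e_' i").

Definition point_vec p C (s t : k) U : 'rV[K]_n :=
  pencil_vec (curve_pencil p C) (xcoord U) (ycoord U) (cst s) (cst t).

Lemma curve_value_pencil p C s t U :
  curve_value (k := k) p C s t U (point_vec p C s t U).
Proof.
apply: seq_span_mem; first exact: regular_subring.
by rewrite mem_curve_gens mem_head.
Qed.

Lemma curve_value_mono p C s t U m : m \in curve_monos p C ->
  curve_value (k := k) p C s t U (mono_vec (xcoord U) (ycoord U) m).
Proof.
move=> hm; apply: seq_span_mem; first exact: regular_subring.
by rewrite mem_curve_gens inE map_f ?orbT.
Qed.

Lemma curve_value_submodule p C s t U : submodule (regular U) (curve_value (k := k) p C s t U).
Proof. exact/seq_span_submodule/regular_subring. Qed.

Lemma curve_value_min p C s t U (S : 'rV[K]_n -> Prop) : submodule (regular U) S ->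
  S (point_vec p C s t U) ->
  (forall m, m \in curve_monos p C -> S (mono_vec (xcoord U) (ycoord U) m)) ->
  forall v, curve_value p C s t U v -> S v.
Proof.
move=> hS hp hm; apply: seq_span_min => // g.
by rewrite mem_curve_gens inE => /orP[/eqP -> //|/mapP [m hin ->]]; apply: hm.
Qed.

Lemma off_in_curve_monos p C l : dl p l -> curve_off C l -> (l, ea p l, eb p l) \in curve_monos p C.
Proof.
move=> dll offl; rewrite mem_cat; apply/orP; right; apply/mapP; exists l => //.
by rewrite mem_filter dll offl mem_enum.
Qed.

Lemma curve_value_rev d r p C s t : in_F d r p -> valid_curve d r p C ->
  eq_subsheaf (curve_value (target C) (rev_curve p C) t s) (curve_value (k := k) p C s t).
Proof.
move=> hp hv U m; have hR := regular_subring k U.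
split; apply: seq_span_sub => // g hg; apply: seq_span_mem => //.
  by rewrite -(curve_gens_rev _ _ _ _ hp hv).
by rewrite (curve_gens_rev _ _ _ _ hp hv).
Qed.

(** At t = 0 the moving generator is x^a_i y^b_i e_i times a nonzero constant
    and, if gamma < 0, times a power of one coordinate. On the affine chart
    where that coordinate is 1 nothing is lost; on the other, x^a_i y^b_i e_i
    is the first fixed generator of the type II curve. *)
Lemma curve_value_start d r p C s : in_F d r p -> valid_curve d r p C -> s != 0 ->
  eq_subsheaf (curve_value p C s 0) (fixed_sheaf k p).
Proof.
move=> hp hv s0 U m; have hR := regular_subring k U.
have hS := fixed_sheaf_submodule k p U.
split.
  apply: curve_value_min => //; last first.
    move=> mm /(curve_monosP hp hv) [? ? ?]; apply: fixed_sheaf_delta.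
    exact: component_mono.
  rewrite /point_vec /pencil_vec rmorph0 !mul0r scale0r addr0 -mulrA.
  apply: fixed_sheaf_delta; have [_ _ hZ] := component_submodule k p U (pc_i (curve_pencil p C)).
  apply: hZ; first exact: regular_cst.
  by case/(valid_curveP hp): hv => {C} /= *; try case: ifP => _ /=; apply: component_mono;
    rewrite ?leq_addr.
have [_ _ hZ] := curve_value_submodule p C s 0 U.
apply: seq_span_min; first exact: curve_value_submodule.
move=> g /mapP [l]; rewrite mem_filter => /andP[/andP[dll _] _] ->.
case offl: (curve_off C l); first exact/(@curve_value_mono _ _ _ _ _ (l, _, _))/off_in_curve_monos.
have start : point_vec p C s 0 U = (cst s * xcoord U ^+ ea p l * ycoord U ^+ eb p l) *: 'e_l ->
    curve_value p C s 0 U ((xcoord U ^+ ea p l * ycoord U ^+ eb p l) *: 'e_l).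
  move=> e; have := hZ _ _ (regular_cst U s^-1) (curve_value_pencil p C s 0 U).
  rewrite e scalerA; congr (curve_value _ _ _ _ _ (_ *: _)).
  by rewrite -[cst s * _ * _]mulrA cstV mulKf // cst_eq0.
have pv0 : point_vec p C s 0 U = let h := curve_pencil p C in
    (cst s * xcoord U ^+ pc_a h * ycoord U ^+ pc_b h) *: 'e_(pc_i h).
  by rewrite /point_vec /pencil_vec rmorph0 !mul0r scale0r addr0.
case/(valid_curveP hp): hv offl start pv0 => {C hZ}.
- move=> i j p' _ _ _ _ _ dj _ _ _ /=; have -> : (l == j) = false.
    by apply/eqP => lj; rewrite -lj dll in dj.
  by move=> offl; have /eqP -> : l == i by case: eqP offl.
- move=> i j p' hp' hA ij di dj _ _ lt e offl start pv0.
  have [lj|lj] := eqVneq l j.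
    by subst l; apply: (@curve_value_mono _ _ _ _ _ (j, _, _)); rewrite !inE eqxx orbT.
  have li : l = i by move: offl => /=; rewrite (negPf lj) orbF => /negbFE/eqP.
  (* For gamma < 0 the moving generator carries a power of y, which is 1 on U0
     and Uboth; at infinity x is 1, and the first fixed generator serves. *)
  subst l; move: start pv0 => /=; case: ifP => _ /= start pv0; first by apply: start; rewrite pv0.
  case: U hR hS start pv0 => hR hS start pv0.
  + by apply: start; rewrite pv0 /= !expr1n.
  + have := @curve_value_mono p (CurveIIa i j p') s 0 Uinf (i, ea p i + (ea p' i - ea p i), eb p i)%N.
    by rewrite !inE eqxx /mono_vec /= !expr1n; apply.
  + by apply: start; rewrite pv0 /= !expr1n.
- move=> i j p' hp' hA ij di dj _ _ lt e offl start pv0.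
  have [lj|lj] := eqVneq l j.
    by subst l; apply: (@curve_value_mono _ _ _ _ _ (j, _, _)); rewrite !inE eqxx orbT.
  have li : l = i by move: offl => /=; rewrite (negPf lj) orbF => /negbFE/eqP.
  (* The same with x and y, 0 and infinity exchanged. *)
  subst l; move: start pv0 => /=; case: ifP => _ /= start pv0; first by apply: start; rewrite pv0.
  case: U hR hS start pv0 => hR hS start pv0.
  + have := @curve_value_mono p (CurveIIb i j p') s 0 U0 (i, ea p i, eb p i + (eb p' i - eb p i))%N.
    by rewrite !inE eqxx /mono_vec /= !expr1n; apply.
  + by apply: start; rewrite pv0 /= !expr1n.
  + have := @curve_value_mono p (CurveIIb i j p') s 0 Uboth (i, ea p i, eb p i + (eb p' i - eb p i))%N.
    by rewrite !inE eqxx /mono_vec /= !expr1n; apply.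
- by move=> i p' _ _ _ _ _ _ /= /negbFE/eqP ->.
Qed.

Lemma curve_value_end d r p C t : in_F d r p -> valid_curve d r p C -> t != 0 ->
  eq_subsheaf (curve_value p C 0 t) (fixed_sheaf k (target C)).
Proof.
move=> hp hv t0; apply: eq_subsheaf_trans (eq_subsheaf_sym (curve_value_rev 0 t hp hv)) _.
by apply: curve_value_start (valid_rev hp hv) t0; case: hv.
Qed.

(** Multiplying the moving generator by a monomial that makes its e_j term
    divisible by x^a y^b, and subtracting that term, isolates the e_i term; s
    is a unit. *)
Lemma pencil_elim U (S : 'rV[K]_n -> Prop) (h : pencil n) (s t : k)
    (u v a b u' v' : nat) : submodule (regular U) S -> s != 0 ->
  (pc_a' h + u = a + u')%N -> (pc_b' h + v = b + v')%N ->
  S (pencil_vec h (xcoord U) (ycoord U) (cst s) (cst t)) ->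
  S (mono_vec (xcoord U) (ycoord U) (pc_j h, a, b)) ->
  S (mono_vec (xcoord U) (ycoord U) (pc_i h, (pc_a h + u)%N, (pc_b h + v)%N)).
Proof.
move=> [_ hD hZ] s0 eu ev hP hM; have hR := regular_subring k U.
have reg (c : k) a1 b1 : regular U (cst c * mono k U a1 b1).
  by apply: subringM; [|exact: regular_cst|exact: regular_mono].
have := hD _ _ (hZ _ _ (reg s^-1 u v) hP) (hZ _ _ (reg (- (s^-1 * t)) u' v') hM).
have eM : mono k U (pc_a' h) (pc_b' h) * mono k U u v = mono k U a b * mono k U u' v'.
  by rewrite !monoM eu ev.
rewrite /pencil_vec /mono_vec /= -!mulrA -!/(mono k U _ _) -monoM.
rewrite scalerDr !scalerA rmorphN /= cstM !cstV.
have cs0 : cst s != 0 by rewrite cst_eq0.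
move: (cst s) (cst t) cs0 (mono k U (pc_a h) (pc_b h)) eM => s' t' s0'.
move: (mono k U (pc_a' h) _) (mono k U u v) (mono k U a b) (mono k U u' v') => A B C D E eM.
rewrite -addrA -scalerDl.
have -> : s'^-1 * B * (t' * A) + - (s'^-1 * t') * D * C = 0.
  have -> : s'^-1 * B * (t' * A) = s'^-1 * t' * (A * B) by ring.
  by rewrite eM; ring.
by rewrite scale0r addr0 mulrACA mulVf // mul1r mulrC.
Qed.

Lemma frame_gens p i (v : chart -> 'rV[K]_n) U :
  [/\ submodule (regular U) (frame_sheaf p i v U), frame_sheaf p i v U (v U)
    & forall l, dl p l -> l != i -> frame_sheaf p i v U
        (mono_vec (xcoord U) (ycoord U) (l, ea p l, eb p l))].
Proof.
have hR := regular_subring k U; split; first exact: seq_span_submodule.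
  by apply: seq_span_mem; rewrite ?mem_head.
move=> l dll li; apply: seq_span_mem => //; rewrite inE fixed_gensE map_f ?orbT //.
by apply/mapP; exists l; rewrite // mem_filter dll /= li mem_enum.
Qed.

Lemma frame_min p i (v : chart -> 'rV[K]_n) U (S : 'rV[K]_n -> Prop) :
  submodule (regular U) S -> S (v U) ->
  (forall l, dl p l -> l != i -> S (mono_vec (xcoord U) (ycoord U) (l, ea p l, eb p l))) ->
  forall w, frame_sheaf p i v U w -> S w.
Proof.
move=> hS hv hm; apply: seq_span_min => // g; rewrite inE => /orP[/eqP -> //|/mapP [l]].
by rewrite mem_filter => /andP[/andP[dll li] _] ->; apply: hm.
Qed.

Lemma curve_off_neq p C l : curve_off C l -> l != pc_i (curve_pencil p C).
Proof.
by case: C => [i j p'|i j p'|i j p'|i p'] /=; try case: ifP => _ /=;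
  rewrite ?negb_or // => /andP[].
Qed.

(** Only the first generator of a type II curve needs an argument. Multiplied
    by x^c (or y^c), the moving generator has e_j term y^gamma (or x^gamma)
    times the second generator, so [pencil_elim] recovers the first one. *)
Lemma curve_monos_in_frame d r p C s t U mm : in_F d r p -> valid_curve d r p C ->
  s != 0 -> 0 <= curve_gap p C -> mm \in curve_monos p C ->
  frame_sheaf p (pc_i (curve_pencil p C)) (point_vec p C s t) U
    (mono_vec (xcoord U) (ycoord U) mm).
Proof.
move=> hp hv s0 hg; have hR := regular_subring k U.
have [fS fv fm] := frame_gens p (pc_i (curve_pencil p C)) (point_vec p C s t) U.
rewrite mem_cat => /orP[|/mapP[l]]; last first.
  rewrite mem_filter => /andP[/andP[dll offl] _] ->; apply: fm => //.
  exact: curve_off_neq offl.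
case/(valid_curveP hp): hv hg fS fv fm => {C} //= i j p' _ _ ij di dj _ _ lt e hg;
  rewrite /point_vec /= hg /= => fS fv fm; rewrite !inE => /orP[] /eqP ->;
  try (by apply: fm; rewrite // eq_sym).
- have := pencil_elim (u := ea p' i - ea p i) (v := 0) (a := ea p j) (b := eb p j)
    (u' := 0) (v' := `|curve_gap p (CurveIIa i j p')|) fS s0 _ _ fv.
  rewrite /= !addn0; apply=> //; last by apply: fm; rewrite // eq_sym.
  by rewrite subnK //; lia.
- have := pencil_elim (u := 0) (v := eb p' i - eb p i) (a := ea p j) (b := eb p j)
    (u' := `|curve_gap p (CurveIIb i j p')|) (v' := 0) fS s0 _ _ fv.
  rewrite /= !addn0; apply=> //; last by apply: fm; rewrite // eq_sym.
  by rewrite subnK //; lia.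
Qed.

Lemma curve_value_frame d r p C s t : in_F d r p -> valid_curve d r p C ->
  s != 0 -> 0 <= curve_gap p C ->
  eq_subsheaf (curve_value p C s t)
    (frame_sheaf p (pc_i (curve_pencil p C)) (point_vec p C s t)).
Proof.
move=> hp hv s0 hg U m; have hR := regular_subring k U.
have [fS fv _] := frame_gens p (pc_i (curve_pencil p C)) (point_vec p C s t) U.
split.
  by apply: curve_value_min => // mm; exact: (curve_monos_in_frame t U hp hv s0 hg).
apply: frame_min; [exact: curve_value_submodule|exact: curve_value_pencil|].
move=> l dll li; apply: curve_value_mono.
case offl: (curve_off C l); first exact: off_in_curve_monos.
case/(valid_curveP hp): hv hg li offl => {C fS fv} /=.
- move=> i j p' _ _ _ _ _ dj _ _ _ _ /= /negPf -> /negbFE/eqP lj.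
  by rewrite lj (negPf dj) in dll.
- by move=> i j p' _ _ _ _ _ _ _ _ _ -> /= /negPf -> /negbFE/eqP ->; rewrite !inE eqxx orbT.
- by move=> i j p' _ _ _ _ _ _ _ _ _ -> /= /negPf -> /negbFE/eqP ->; rewrite !inE eqxx orbT.
- by move=> i p' _ _ _ _ _ _ _ /= /negPf ->.
Qed.

End CurveSheaves.

(** * The torus action *)

Lemma act_scalar_shuffle (R : comNzRingType) (e s y q m : R) :
  e * (s * (y * q * m)) = y * (s * (e * q) * m).
Proof. by ring. Qed.

Section Action.
Variables (k : closedFieldType) (n : nat).
Local Notation K := (ratfun k).
Local Notation zvar := (@zvar k).
Local Notation cst := (@cst k).
Implicit Types (U : chart) (f : K) (p : triple n) (C : curve n) (g : torus k n).
Local Notation "''e_' i" := (delta_mx 0 i : 'rV_n)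
  (at level 8, i at level 2, format "''e_' i").

Lemma torus_pt_inv g : torus_pt g -> torus_pt (tinv g).
Proof. by case=> h q0; split=> [i|] /=; rewrite ?ffunE invr_eq0. Qed.

Section Point.
Variables (g : torus k n) (hg : torus_pt g).
Let q0 : tq g != 0 := proj2 hg.

Lemma act_vec_delta f l :
  act_vec g (f *: 'e_l) = (cst (tdiag g l) * dilate (tq g) f) *: 'e_l.
Proof.
apply/rowP => l'; rewrite !mxE eqxx /=; case: eqP => [->|_]; rewrite ?mulr1 //.
by rewrite !mulr0 dilate0 // mulr0.
Qed.

Lemma act_vecD m m' : act_vec g (m + m') = act_vec g m + act_vec g m'.
Proof. by apply/rowP => l; rewrite !mxE dilateD // mulrDr. Qed.

Lemma act_vecB m m' : act_vec g (m - m') = act_vec g m - act_vec g m'.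
Proof. by apply/rowP => l; rewrite !mxE dilateB // mulrBr. Qed.

Lemma act_vec0 : act_vec g 0 = 0.
Proof. by have := act_vecB 0 0; rewrite !subrr. Qed.

Lemma act_vecZ f m : act_vec g (f *: m) = dilate (tq g) f *: act_vec g m.
Proof. by apply/rowP => l; rewrite !mxE dilateM // mulrCA. Qed.

Lemma act_vecK m : act_vec g (act_vec (tinv g) m) = m.
Proof.
have hD := proj1 hg; apply/rowP => l; rewrite !mxE ffunE dilateM // dilate_cst // dilateK //.
by rewrite mulrA -cstM mulfV // cst1 mul1r.
Qed.

(** The action on vectors is semilinear for the dilation, which preserves each
    ring of regular functions; so inclusions between spans may be checked on
    generators after acting. *)
Lemma act_submodule U (S : 'rV[K]_n -> Prop) :
  submodule (regular U) S -> submodule (regular U) (fun m => S (act_vec g m)).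
Proof.
case=> h0 hD hZ; split; first by rewrite act_vec0.
  by move=> v w hv hw; rewrite act_vecD; apply: hD.
by move=> c v hc hv; rewrite act_vecZ; apply: hZ => //; apply: regular_dilate.
Qed.

Lemma act_mono U (m : monomial n) :
  act_vec g (mono_vec (xcoord U) (ycoord U) m) =
  cst (tdiag g m.1.1 * (yscale U (tq g) ^+ (m.1.2 + m.2) * tq g ^+ m.1.2))
    *: mono_vec (xcoord U) (ycoord U) m.
Proof.
by rewrite /mono_vec act_vec_delta -/(mono k U _ _) dilate_mono // scalerA !cstM !mulrA.
Qed.

(** The torus element moves the point [s, t] of the curve to [s act_s, t
    act_t]; the factors are the same on all charts. *)
Definition act_s p C : k :=
  let h := curve_pencil p C in tdiag g (pc_i h) * tq g ^+ pc_a h.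
Definition act_t p C : k :=
  let h := curve_pencil p C in tdiag g (pc_j h) * tq g ^+ pc_a' h.

(** Homogeneity of the moving generator turns the dependence on the chart into
    an overall constant, so one point [s', t'] serves all charts. *)
Lemma act_point d r p C s t U : in_F d r p -> valid_curve d r p C ->
  let h := curve_pencil p C in
  act_vec g (point_vec p C s t U) =
  cst (yscale U (tq g) ^+ (pc_a h + pc_b h)) *:
    point_vec p C (s * act_s p C) (t * act_t p C) U.
Proof.
move=> hp hv /=; have hb := pencil_balanced hp hv.
rewrite /point_vec /pencil_vec act_vecD !act_vec_delta -!mulrA.
rewrite -!/(mono k U _ _) !(dilateM q0 (cst _)) !dilate_cst // !dilate_mono // scalerDr !scalerA -hb.
by rewrite /act_s /act_t !cstM; congr (_ *: _ + _ *: _); apply: act_scalar_shuffle.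
Qed.

Lemma act_curve d r p C s t U m : in_F d r p -> valid_curve d r p C ->
  curve_value p C s t U m ->
  curve_value p C (s * act_s p C) (t * act_t p C) U (act_vec g m).
Proof.
move=> hp hv; have hS := curve_value_submodule p C (s * act_s p C) (t * act_t p C) U.
have [_ _ hZ] := hS.
apply: (curve_value_min (S := fun m => curve_value _ _ _ _ U (act_vec g m))).
- exact: act_submodule.
- rewrite (act_point _ _ _ hp hv); apply: hZ; first exact: regular_cst.
  exact: curve_value_pencil.
- move=> mm hmm; rewrite act_mono; apply: hZ; first exact: regular_cst.
  exact: curve_value_mono.
Qed.

Lemma act_fixed p U m : fixed_sheaf k p U m -> fixed_sheaf k p U (act_vec g m).
Proof.
have hS := fixed_sheaf_submodule k p U; have [_ _ hZ] := hS.
apply: (seq_span_min (S := fun m => fixed_sheaf k p U (act_vec g m))).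
  exact: act_submodule.
move=> v; rewrite fixed_gensE => hv.
have hv' : fixed_sheaf k p U v.
  by apply: seq_span_mem; rewrite ?fixed_gensE //; exact: regular_subring.
case/mapP: hv hv' => mm _ -> hm.
by rewrite act_mono; apply: hZ => //; exact: regular_cst.
Qed.

End Point.

Lemma act_sheaf_eq g (S S' : subsheaf k n) : torus_pt g ->
  (forall U m, S U m -> S' U (act_vec g m)) ->
  (forall U m, S' U m -> S U (act_vec (tinv g) m)) ->
  eq_subsheaf (act_sheaf g S) S'.
Proof. by move=> hg h h' U m; split=> [/h|/h' //]; rewrite act_vecK. Qed.

Lemma act_fixed_sheaf g p : torus_pt g ->
  eq_subsheaf (act_sheaf g (fixed_sheaf k p)) (fixed_sheaf k p).
Proof.
move=> hg; apply: act_sheaf_eq => // U m; apply: act_fixed => //.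
exact: torus_pt_inv.
Qed.

Lemma act_s_inv g p C : torus_pt g ->
  act_s g p C != 0 /\ act_s (tinv g) p C = (act_s g p C)^-1.
Proof.
move=> [hD q0]; rewrite /act_s /= ffunE exprVn invfM; split=> //.
by rewrite mulf_neq0 ?expf_neq0.
Qed.

Lemma act_t_inv g p C : torus_pt g ->
  act_t g p C != 0 /\ act_t (tinv g) p C = (act_t g p C)^-1.
Proof.
move=> [hD q0]; rewrite /act_t /= ffunE exprVn invfM; split=> //.
by rewrite mulf_neq0 ?expf_neq0.
Qed.

Lemma act_curve_value g d r p C s t : torus_pt g -> in_F d r p -> valid_curve d r p C ->
  eq_subsheaf (act_sheaf g (curve_value p C s t))
    (curve_value p C (s * act_s g p C) (t * act_t g p C)).
Proof.
move=> hg hp hv; have [s0 sE] := act_s_inv p C hg; have [t0 tE] := act_t_inv p C hg.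
apply: act_sheaf_eq => // U m h; first exact: (act_curve hg hp hv h).
by have := act_curve (torus_pt_inv hg) hp hv h; rewrite sE tE !mulfK.
Qed.

End Action.

(** * The curves lie in the quot scheme *)

Section InQuot.
Variables (k : closedFieldType) (n : nat).
Local Notation K := (ratfun k).
Local Notation zvar := (@zvar k).
Local Notation cst := (@cst k).
Implicit Types (U : chart) (f : K) (p : triple n) (C : curve n) (g : torus k n).
Local Notation "''e_' i" := (delta_mx 0 i : 'rV_n)
  (at level 8, i at level 2, format "''e_' i").

Lemma pencil_start d r p C : in_F d r p -> valid_curve d r p C -> 0 <= curve_gap p C ->
  let h := curve_pencil p C in
  [/\ dl p (pc_i h), pc_a h = ea p (pc_i h) & pc_b h = eb p (pc_i h)].
Proof.
move=> hp /(valid_curveP hp) [] {C} /=.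
- by [].
- by move=> i j p' _ _ _ di _ _ _ _ _ ->.
- by move=> i j p' _ _ _ di _ _ _ _ _ ->.
- by [].
Qed.

(** In type III the two terms add up in the same coordinate; they cannot
    cancel because the exponents of z differ. *)
Lemma point_vec_pivot d r p C s t : in_F d r p -> valid_curve d r p C -> s != 0 ->
  point_vec (k := k) p C s t U0 0 (pc_i (curve_pencil p C)) != 0.
Proof.
move=> hp hv s0; have cs0 : cst s != 0 by rewrite cst_eq0.
have piv (h : pencil n) : pc_i h != pc_j h ->
    pencil_vec h (xcoord U0) (ycoord U0) (cst s) (cst t) 0 (pc_i h) != 0 :> K.
  move=> /negPf ij; rewrite !mxE !eqxx ij /= mulr0 addr0 mulr1 -mulrA.
  by apply: mulf_neq0; [exact: cs0|exact: (mono_neq0 k U0)].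
case/(valid_curveP hp): hv => {C}; rewrite /point_vec.
- by move=> i j p' *; apply: piv.
- by move=> i j p' *; apply: piv; rewrite /=; case: ifP.
- by move=> i j p' *; apply: piv; rewrite /=; case: ifP.
- move=> i p' _ _ _ _ na _; rewrite !mxE !eqxx /= !mulr1 !expr1n !mulr1.
  rewrite -!tofracXn -!tofracM -tofracD tofrac_eq0.
  apply/eqP => /(congr1 (fun w : {poly k} => w`_(ea p i))).
  rewrite coefD !coefCM !coefXn eqxx (negPf na) mulr1 mulr0 addr0 coef0.
  by move/eqP; apply/negP.
Qed.

Lemma in_quot_curve_frame d r p C s t : in_F d r p -> valid_curve d r p C -> s != 0 ->
  0 <= curve_gap p C -> in_quot d r (curve_value (k := k) p C s t).
Proof.
move=> hp hv s0 hg; apply: in_quot_eq (eq_subsheaf_sym (curve_value_frame t hp hv s0 hg)) _.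
have [dli ai bi] := pencil_start hp hv hg; have hb := pencil_balanced hp hv.
apply: in_quot_frame => //.
- rewrite /point_vec /pencil_vec scalerDr !scalerA -!mulrA -!/(mono k _ _ _) !mono_Uinf_U0.
  by rewrite -ai -bi -hb !mulrA ![cst _ * _]mulrC.
- move=> U l; have hR := regular_subring k U; rewrite !mxE.
  have rb (b : bool) : regular U (b%:R : K).
    by case: b; [exact: subring1 hR|exact: subring0 hR].
  have rm (u : k) a b : regular U (cst u * xcoord U ^+ a * ycoord U ^+ b).
    by rewrite -mulrA; apply: (subringM hR); [exact: regular_cst|exact: regular_mono].
  by apply: (subringD hR); apply: (subringM hR); first [exact: rm|exact: rb].
- exact: (point_vec_pivot t hp hv s0).
Qed.

(** Since r < n there is a summand at all, and the fixed sheaf is its own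
    frame sheaf. *)
Lemma in_quot_fixed d r p : (r < n)%N -> in_F d r p -> in_quot d r (fixed_sheaf k p).
Proof.
move=> hr hp.
have [i dli] : exists i, dl p i.
  apply/existsP; apply: contraTT hr; rewrite negb_exists => /forallP h.
  have [+ _ _] := hp; rewrite big1 => [|i _]; last by rewrite (negPf (h i)).
  by lia.
pose v U := mono_vec (R := K) (xcoord U) (ycoord U) (i, ea p i, eb p i).
have e : eq_subsheaf (frame_sheaf p i v) (fixed_sheaf k p).
  move=> U m; have hR := regular_subring k U.
  have gens l : dl p l -> mono_vec (xcoord U) (ycoord U) (l, ea p l, eb p l)
      \in fixed_gens p predT (xcoord U : K) (ycoord U).
    move=> dll; rewrite fixed_gensE map_f //; apply/mapP; exists l => //.
    by rewrite mem_filter dll mem_enum.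
  split.
    apply: frame_min; first exact: fixed_sheaf_submodule.
      by apply: seq_span_mem => //; apply: gens.
    by move=> l dll _; apply: seq_span_mem => //; apply: gens.
  have [fS fv fm] := frame_gens p i v U; apply: seq_span_min => // w /mapP [l].
  rewrite mem_filter => /andP[/andP[dll _] _] ->.
  by have [->|li] := eqVneq l i; [exact: fv|exact: fm].
apply: in_quot_eq e _; apply: in_quot_frame => //.
- by rewrite /v /mono_vec /= scalerA; congr (_ *: _); exact: mono_Uinf_U0.
- move=> U l; have hR := regular_subring k U; rewrite !mxE; apply: subringM => //.
    exact: regular_mono.
  by case: (_ && _); [exact: subring1|exact: subring0].
- by rewrite !mxE !eqxx mulr1; exact: (mono_neq0 k U0).
Qed.

(** The points with s or t zero are fixed sheaves. At all others the curve or
    its reversal has gamma >= 0, and [curve_value_frame] applies. *)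
Lemma in_quot_curve d r p C s t : (r < n)%N -> in_F d r p -> valid_curve d r p C ->
  (s, t) != (0, 0) -> in_quot d r (curve_value (k := k) p C s t).
Proof.
move=> hr hp hv; have hp' : in_F d r (target C) by case: hv.
rewrite xpair_eqE negb_and => st.
have [s0|s0] := eqVneq s 0.
  subst s; rewrite eqxx /= in st.
  exact: in_quot_eq (eq_subsheaf_sym (curve_value_end hp hv st)) (in_quot_fixed hr hp').
have [t0|t0] := eqVneq t 0.
  subst t; exact: in_quot_eq (eq_subsheaf_sym (curve_value_start hp hv s0)) (in_quot_fixed hr hp).
have [hg|/ltW hg] := leP 0 (curve_gap p C); first exact: in_quot_curve_frame.
apply: in_quot_eq (curve_value_rev s t hp hv) _.
apply: in_quot_curve_frame => //; first exact: valid_rev.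
by rewrite (curve_gap_rev hp hv) oppr_ge0.
Qed.

Lemma T_invariant_curve_value d r p C : (r < n)%N -> in_F d r p -> valid_curve d r p C ->
  T_invariant_curve d r (curve_value (k := k) p C).
Proof.
move=> hr hp hv; split=> [s t|g s t hg st]; first exact: in_quot_curve.
exists (s * act_s g p C), (t * act_t g p C); split; last exact: act_curve_value hg hp hv.
have [s0 _] := act_s_inv p C hg; have [t0 _] := act_t_inv p C hg.
by move: st; rewrite !xpair_eqE (mulf_eq0 s) (mulf_eq0 t) (negPf s0) (negPf t0) !orbF.
Qed.

End InQuot.

(** * Functions on the two affine charts as polynomials *)

Section LocalCoordinate.
Variable k : closedFieldType.
Local Notation K := (ratfun k).
Local Notation zvar := (@zvar k).
Local Notation cst := (@cst k).
Local Notation tofrac := (@tofrac {poly k}).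
Implicit Types (U : chart) (f : K) (w : {poly k}).

(** The coordinate of an affine chart; its powers generate the summands of the
    fixed sheaf there, which puts the points 0 and infinity on the same
    footing. *)
Definition lcoord U : K := if U is Uinf then zvar^-1 else zvar.
Definition leval U w : K := (map_poly cst w).[lcoord U].

Lemma levalB U w w' : leval U (w - w') = leval U w - leval U w'.
Proof. by rewrite /leval rmorphB !hornerE. Qed.
Lemma leval0 U : leval U 0 = 0.
Proof. by rewrite /leval rmorph0 horner0. Qed.
Lemma levalD U w w' : leval U (w + w') = leval U w + leval U w'.
Proof. by rewrite /leval rmorphD !hornerE. Qed.
Lemma levalM U w w' : leval U (w * w') = leval U w * leval U w'.
Proof. by rewrite /leval rmorphM hornerM. Qed.
Lemma levalXn U m : leval U 'X^m = lcoord U ^+ m.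
Proof. by rewrite /leval map_polyXn hornerXn. Qed.
Lemma levalZ U c w : leval U (c *: w) = cst c * leval U w.
Proof. by rewrite /leval map_polyZ hornerZ. Qed.
Lemma leval_sum U (I : Type) (r : seq I) (F : I -> {poly k}) :
  leval U (\sum_(l <- r) F l) = \sum_(l <- r) leval U (F l).
Proof. exact: (big_morph _ (levalD U) (leval0 U)). Qed.

Lemma leval_coef U w N : (size w <= N)%N ->
  leval U w = \sum_(c < N) cst w`_c * lcoord U ^+ c.
Proof.
move=> hw; rewrite /leval (@horner_coef_wide _ N).
  by apply: eq_bigr => c _; rewrite coef_map.
exact: leq_trans (size_poly _ _) hw.
Qed.

Lemma leval_split U w N : leval U w
  = \sum_(c < N) cst w`_c * lcoord U ^+ c + leval U (drop_poly N w) * lcoord U ^+ N.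
Proof.
rewrite -{1}(poly_take_drop N w) levalD levalM levalXn; congr (_ + _).
rewrite (@leval_coef _ _ N) ?size_take_poly //; apply: eq_bigr => c _.
by rewrite coef_take_poly ltn_ord.
Qed.

Lemma regularP U f : U <> Uboth -> regular U f <-> exists w, f = leval U w.
Proof. by case: U => //= _; rewrite /leval; split=> -[w ->]; exists w; rewrite // tofracE. Qed.

(** Clearing denominators in 1/z reverses the list of coefficients. *)
Lemma leval_Uinf_rev w N : (size w <= N.+1)%N ->
  leval Uinf w * zvar ^+ N = tofrac (\poly_(l < N.+1) w`_(N - l)).
Proof.
move=> hw; rewrite (leval_coef _ hw) mulr_suml (reindex_inj rev_ord_inj) /=.
rewrite poly_def rmorph_sum /=; apply: eq_bigr => l _.
rewrite subSS tofracZ tofracXn -mulrA; congr (_ * _).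
have hl : (l <= N)%N by rewrite -ltnS.
rewrite -[in zvar ^+ N](subnK hl) exprD mulrA exprVn mulVf ?mul1r //.
by rewrite expf_neq0 ?zvar_neq0.
Qed.

Lemma leval_inj U w : leval U w = 0 -> w = 0.
Proof.
case: U.
- by rewrite /leval -tofracE => /eqP; rewrite tofrac_eq0 => /eqP.
- move=> e; have := leval_Uinf_rev (leqnSn (size w)).
  rewrite e mul0r => /esym/eqP; rewrite tofrac_eq0 => /eqP h.
  apply/polyP => l; rewrite coef0; have [hl|/leq_sizeP -> //] := ltnP l (size w).
  have /(congr1 (fun v : {poly k} => v`_(size w - l))) := h.
  rewrite coef_poly coef0 ltnS leq_subr subKn //; exact: ltnW.
- by rewrite /leval -tofracE => /eqP; rewrite tofrac_eq0 => /eqP.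
Qed.

(** The sections of O(N) on the projective line are the polynomials of degree
    at most N. *)
Lemma degree_bound w w' N : leval U0 w = zvar ^+ N * leval Uinf w' -> (size w <= N.+1)%N.
Proof.
have [->|w0] := eqVneq w 0; first by rewrite size_poly0.
set M := size w' => h.
have e : w * 'X^M = 'X^N * \poly_(l < M.+1) w'`_(M - l).
  apply/eqP; rewrite -tofrac_eq !tofracM -leval_Uinf_rev // !tofracXn.
  by rewrite [X in X * _]tofracE -/(leval U0 w) h mulrA.
have : (size (w * 'X^M)%R <= N + M.+1)%N.
  rewrite e mulrC; have [->|q0] := eqVneq (\poly_(l < M.+1) w'`_(M - l)) 0.
    by rewrite mul0r size_poly0.
  by rewrite size_mulXn // leq_add2l size_poly.
by rewrite size_mulXn // addnC addnS -addSn leq_add2r.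
Qed.

End LocalCoordinate.

(** * Homomorphisms into the quotient *)

Section Homs.
Variables (k : closedFieldType) (n : nat).
Local Notation K := (ratfun k).
Local Notation cst := (@cst k).
Local Notation premor := (premor k n).
Implicit Types (U : chart) (p : triple n) (phi psi : premor).

Section Closure.
Variable p : triple n.
Local Notation S := (fixed_sheaf k p).

Let S0 U : S U 0. Proof. by have [] := fixed_sheaf_submodule k p U. Qed.
Let SD U m m' : S U m -> S U m' -> S U (m + m').
Proof. by have [_ + _] := fixed_sheaf_submodule k p U; apply. Qed.
Let SB U m m' : S U m -> S U m' -> S U (m - m'). Proof. exact: fixed_sheafB. Qed.
Let SZ U c m : regular U c -> S U m -> S U (c *: m).
Proof. by have [_ _] := fixed_sheaf_submodule k p U; apply. Qed.

Lemma fixed_sheaf_regular U m l : S U m -> regular U (m 0 l).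
Proof. by move/fixed_sheafP/(_ l); apply: component_sub. Qed.

Definition add_hom phi psi : premor := fun U m => phi U m + psi U m.

Lemma is_hom_zero : is_hom S (@zero_hom k n).
Proof.
split=> [U m _ j|U c m m' _ _ _|U m _] /=; rewrite /zero_hom.
- by rewrite mxE; apply: subring0; apply: regular_subring.
- by rewrite scaler0 !addr0 subr0.
- by rewrite subr0.
Qed.

Lemma is_hom_add phi psi : is_hom S phi -> is_hom S psi -> is_hom S (add_hom phi psi).
Proof.
move=> [h1 h2 h3] [g1 g2 g3]; split=> [U m hm j|U c m m' hc hm hm'|U m hm]; rewrite /add_hom.
- rewrite mxE; apply: subringD; [exact: regular_subring|exact: h1|exact: g1].
- have := SD (h2 _ _ _ _ hc hm hm') (g2 _ _ _ _ hc hm hm').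
  by congr (S _ _); rewrite scalerDr; apply/rowP => l; rewrite !mxE; ring.
- have := SD (h3 _ _ hm) (g3 _ _ hm).
  by congr (S _ _); apply/rowP => l; rewrite !mxE; ring.
Qed.

Lemma is_hom_scale u phi : is_hom S phi -> is_hom S (scale_hom u phi).
Proof.
move=> [h1 h2 h3]; split=> [U m hm j|U c m m' hc hm hm'|U m hm]; rewrite /scale_hom.
- rewrite mxE; apply: subringM; [exact: regular_subring|exact: regular_cst|exact: h1].
- have := SZ (regular_cst U u) (h2 _ _ _ _ hc hm hm').
  by congr (S _ _); apply/rowP => l; rewrite !mxE; ring.
- have := SZ (regular_cst Uboth u) (h3 _ _ hm).
  by rewrite scalerBr.
Qed.

Lemma eq_is_hom phi psi : (forall U m, phi U m = psi U m) -> is_hom S phi -> is_hom S psi.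
Proof.
move=> e [h1 h2 h3]; split=> [U m hm j|U c m m' hc hm hm'|U m hm]; rewrite -!e.
- exact: h1.
- exact: h2.
- exact: h3.
Qed.

Lemma is_hom_sum (I : Type) (r : seq I) (F : I -> premor) :
  (forall i, is_hom S (F i)) -> is_hom S (fun U m => \sum_(i <- r) F i U m).
Proof.
move=> h; elim: r => [|i r ih].
  by apply: eq_is_hom is_hom_zero => U m; rewrite big_nil.
by apply: eq_is_hom (is_hom_add (h i) ih) => U m; rewrite big_cons.
Qed.

(** Homomorphisms are linear only modulo the sheaf, so the comparison is
    carried through the span together with membership. *)
Lemma hom_eq_gens phi psi U : is_hom S phi -> is_hom S psi ->
  (forall l, dl p l -> let m := mono_vec (xcoord U) (ycoord U) (l, ea p l, eb p l) in
     S U (phi U m - psi U m)) ->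
  forall m, S U m -> S U (phi U m - psi U m).
Proof.
move=> [_ h2 _] [_ g2 _] hgen.
have hR := regular_subring k U.
have lin c m m' : regular U c -> S U m -> S U m' -> S U (phi U m - psi U m) ->
    S U (phi U m' - psi U m') -> S U (phi U (c *: m + m') - psi U (c *: m + m')).
  move=> hc hm hm' e e'.
  have := SD (SB (h2 U c m m' hc hm hm') (g2 U c m m' hc hm hm')) (SD (SZ hc e) e').
  by congr (S _ _); apply/rowP => l; rewrite !mxE; ring.
have e0 : S U (phi U 0 - psi U 0).
  have h := h2 U 1 0 0 (subring1 hR) (S0 U) (S0 U).
  have g := g2 U 1 0 0 (subring1 hR) (S0 U) (S0 U).
  have := SB g h.
  by congr (S _ _); rewrite !scale1r addr0; apply/rowP => l; rewrite !mxE; ring.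
suff h m : S U m -> S U m /\ S U (phi U m - psi U m) by move=> m /h[].
apply: (seq_span_min (S := fun m => S U m /\ S U (phi U m - psi U m))).
  split=> [|v w [hv ev] [hw ew]|c v hc [hv ev]]; first by split.
  - by split; [exact: SD|rewrite -[v]scale1r; apply: lin => //; exact: subring1].
  - by split; [exact: SZ|rewrite -[c *: v]addr0; apply: lin].
move=> g hg; split; first exact: seq_span_mem.
move: hg; rewrite fixed_gensE => /mapP [_ /mapP [l + ->] ->].
by rewrite mem_filter => /andP[/andP[dll _] _]; exact: hgen.
Qed.

(** The spanning clause of [is_basis]; isolated so that the expansion of a
    homomorphism can be assembled by sums. *)
Definition spannable (I : Type) (D : I -> Prop) (v : I -> premor) phi : Prop :=
  exists (N : nat) (x : 'I_N -> I) (c : 'I_N -> k),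
    (forall l, D (x l)) /\ eq_hom S phi (lincomb c (fun l => v (x l))).

Section Spannable.
Variables (I : Type) (D : I -> Prop) (v : I -> premor).
Local Notation spannable := (spannable D v).

Lemma spannable_zero : spannable (@zero_hom k n).
Proof.
exists 0%N, (fun l : 'I_0 => match l with Ordinal _ h => match notF h with end end), (fun=> 0).
by split=> [[]//|U m _]; rewrite /lincomb big_ord0 subr0.
Qed.

Lemma spannable_gen u x : D x -> spannable (scale_hom u (v x)).
Proof.
move=> hx; exists 1%N, (fun=> x), (fun=> u); split=> // U m _.
by rewrite /lincomb big_ord1 subrr.
Qed.

Lemma spannable_add phi psi : spannable phi -> spannable psi -> spannable (add_hom phi psi).
Proof.
move=> [N [x [c [hx hc]]]] [M [y [e [hy he]]]].
exists (N + M)%N, (fun l => match split l with inl a => x a | inr b => y b end),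
  (fun l => match split l with inl a => c a | inr b => e b end).
split=> [l|U m hm]; first by case: (split l).
have -> : add_hom phi psi U m - lincomb (fun l => match split l with inl a => c a | inr b => e b end)
    (fun l => v (match split l with inl a => x a | inr b => y b end)) U m
    = (phi U m - lincomb c (fun l => v (x l)) U m) + (psi U m - lincomb e (fun l => v (y l)) U m).
  rewrite addrACA -opprD; congr (_ - _).
  rewrite {1}/lincomb big_split_ord; congr (_ + _); apply: eq_bigr => l _.
    by rewrite (unsplitK (inl _ l)).
  by rewrite (unsplitK (inr _ l)).
exact: SD (hc U m hm) (he U m hm).
Qed.

Lemma spannable_sum (J : Type) (r : seq J) (F : J -> premor) :
  (forall j, spannable (F j)) -> spannable (fun U m => \sum_(j <- r) F j U m).
Proof.
move=> h; elim: r => [|j r ih].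
  have [N [x [c [hx hc]]]] := spannable_zero; exists N, x, c; split=> // U m hm.
  by rewrite big_nil; exact: hc.
have [N [x [c [hx hc]]]] := spannable_add (h j) ih; exists N, x, c; split=> // U m hm.
by rewrite big_cons; exact: hc.
Qed.

Lemma spannable_eq phi psi : eq_hom S phi psi -> spannable psi -> spannable phi.
Proof.
move=> e [N [x [c [hx hc]]]]; exists N, x, c; split=> // U m hm.
by have := SD (e U m hm) (hc U m hm); rewrite addrA subrK.
Qed.

End Spannable.
End Closure.
End Homs.

(** * The basis homomorphisms and their independence *)

Section Basis.
Variables (k : closedFieldType) (n : nat) (p : triple n).
Local Notation K := (ratfun k).
Local Notation zvar := (@zvar k).
Local Notation cst := (@cst k).
Local Notation premor := (premor k n).
Implicit Types (U : chart) (phi psi : premor) (x y : basis_label n).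
Local Notation S := (fixed_sheaf k p).
Local Notation gmono U l := (mono k U (ea p l) (eb p l)).
Local Notation "''e_' i" := (delta_mx 0 i : 'rV[K]_n)
  (at level 8, i at level 2, format "''e_' i").

(** Whether the basis element of the label acts on the chart by its formula
    rather than by zero. *)
Definition acts x U : bool :=
  match x, U with Bfree _ _ _, _ | Bzero _ _ _, U0 | Binf _ _ _, Uinf => true | _, _ => false end.

Lemma basis_vecE x U m j :
  basis_vec k p x U m 0 j =
  if acts x U && (j == col_of x)
  then m 0 (row_of x) * zvar ^ label_exponent p x else 0.
Proof.
rewrite /basis_vec; case: x U => [i j' c|i j' c|i j' c] [] //=;
  by rewrite !mxE ?eqxx //=; case: eqP => _; rewrite ?mulr1 ?mulr0.
Qed.

(** On an affine chart where the basis element acts, it sends the generator of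
    the row summand to this power of the local coordinate, times e_col. *)
Definition image_exponent x U : nat :=
  let e := label_exponent p x in
  if U is Uinf then `|(eb p (row_of x))%:Z - e| else `|(ea p (row_of x))%:Z + e|.

Definition gen_exponent U l : nat := if U is Uinf then eb p l else ea p l.

Lemma gmonoE U l : gmono U l = lcoord k U ^+ gen_exponent U l.
Proof. by case: U; rewrite /mono /= expr1n ?mulr1 ?mul1r. Qed.

Lemma dl_row x : valid_label p x -> dl p (row_of x).
Proof. by case: x => [i j c|i j c|i j c] []. Qed.

Lemma value_image_exponent x U : valid_label p x -> acts x U -> U <> Uboth ->
  gmono U (row_of x) * zvar ^ label_exponent p x = lcoord k U ^+ image_exponent x U.
Proof.
have z0 := zvar_neq0 k; case: U => // hx ha _.
  rewrite monoU0 -expfzDr // /lcoord exprnP /image_exponent; congr (_ ^ _).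
  by case: x hx ha => [i j c|i j c|i j c] //= -[] *; lia.
rewrite monoUinf -expfzDr // /lcoord exprVn exprnN /image_exponent; congr (_ ^ _).
by case: x hx ha => [i j c|i j c|i j c] //= -[] *; lia.
Qed.

Lemma regular_value x U : valid_label p x -> acts x U ->
  regular U (gmono U (row_of x) * zvar ^ label_exponent p x).
Proof.
move=> hx; case: U => ha.
- by rewrite value_image_exponent //; apply: subringX (regular_subring k U0) _ _ _; exact: regular_xcoord.
- by rewrite value_image_exponent //; apply: subringX (regular_subring k Uinf) _ _ _; exact: regular_ycoord.
- by rewrite monoUboth -expfzDr ?zvar_neq0 //; exact: regular_zvarz.
Qed.

Lemma elementaryP i j e c (m m' : 'rV[K]_n) :
  elementary i j e (c *: m + m') = c *: elementary i j e m + elementary i j e m'.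
Proof. by rewrite /elementary scalerA -scalerDl !mxE mulrDl !mulrA. Qed.

Lemma basis_vecP x U c m m' :
  basis_vec k p x U (c *: m + m') = c *: basis_vec k p x U m + basis_vec k p x U m'.
Proof.
rewrite /basis_vec; case: x U => [i j e|i j e|i j e] []; rewrite ?elementaryP //;
  by rewrite scaler0 addr0.
Qed.

Lemma basis_vec_regular x U m j : valid_label p x -> S U m ->
  regular U (basis_vec k p x U m 0 j).
Proof.
move=> hx hm; have hR := regular_subring k U.
rewrite basis_vecE; case: ifP => [/andP[ha _]|_]; last exact: subring0.
have /fixed_sheafP/(_ (row_of x)) [g hg ->] := hm.
by rewrite (dl_row hx) -mulrA; apply: subringM => //; exact: regular_value.
Qed.

Lemma basis_vec_is_hom x : valid_label p x -> is_hom S (basis_vec k p x).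
Proof.
move=> hx; split=> [U m hm j|U c m m' hc hm hm'|U m hm].
- exact: basis_vec_regular.
- by rewrite basis_vecP subrr; have [] := fixed_sheaf_submodule k p U.
- apply/fixed_sheafP => j; rewrite !mxE !basis_vecE.
  have hB := regular_subring k Uboth.
  have [->|ne] := eqVneq j (col_of x); last first.
    by rewrite !andbF subr0; have [c0 _ _] := component_submodule k p Uboth j.
  have hr : acts x U -> regular Uboth (m 0 (row_of x) * zvar ^ label_exponent p x).
    move=> ha; apply: (@regular_Uboth _ U); move: (basis_vec_regular (col_of x) hx hm).
    by rewrite basis_vecE ha eqxx.
  have comp0 f : dl p (col_of x) -> regular Uboth f -> component p Uboth (col_of x) f.
    exact: component_Uboth.
  have [c0 _ _] := component_submodule k p Uboth (col_of x).
  rewrite !andbT; case: x hx hr comp0 c0 => [i j' c|i j' c|i j' c] /=.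
  + by move=> _ _ _ c0; rewrite subrr.
  + case=> _ dj _ hr comp0 c0; case: U {hm} hr => hr; rewrite ?subr0 // sub0r.
    by apply: comp0 => //; apply: (subringN hB); exact: hr.
  + case=> _ dj _ hr comp0 c0; case: U {hm} hr => hr; rewrite ?subr0 // sub0r.
    by apply: comp0 => //; apply: (subringN hB); exact: hr.
Qed.

(** A chart on which the basis element of the label is detected: its value on
    the row generator there is a monomial that is nonzero modulo the column
    summand. *)
Definition witness_chart y : chart := if y is Binf _ _ _ then Uinf else U0.

(** Among the basis elements with a given row and column, those that act on
    the witness chart of y have distinct exponents. Labels Bfree cannot meet
    the others because they require delta to vanish at the column. *)
Lemma image_exponent_inj x y : valid_label p x -> valid_label p y -> acts x (witness_chart y) ->
  row_of x = row_of y -> col_of x = col_of y ->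
  image_exponent x (witness_chart y) = image_exponent y (witness_chart y) -> x = y.
Proof.
case: y => [i j c|i j c|i j c]; case: x => [i' j' c'|i' j' c'|i' j' c'] //=.
- by move=> [_ _ ? ?] [_ _ ? ?] _ ei ej; subst; rewrite /image_exponent /= => e; congr Bfree; lia.
- by move=> [_ dj _] [_ dj' _ _] _ _ e; rewrite -e dj in dj'.
- by move=> [_ dj _ _] [_ dj' _] _ _ e; rewrite e dj' in dj.
- by move=> [_ _ ?] [_ _ ?] _ ei ej; subst; rewrite /image_exponent /= => e; congr Bzero; lia.
- by move=> [_ dj _ _] [_ dj' _] _ _ e; rewrite e dj' in dj.
- by move=> [_ _ ?] [_ _ ?] _ ei ej; subst; rewrite /image_exponent /= => e; congr Binf; lia.
Qed.

Lemma acts_witness_chart y : acts y (witness_chart y) /\ witness_chart y <> Uboth.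
Proof. by case: y. Qed.

(** The monomial is nonzero in the torsion sheaf: its exponent is below the
    order of the column generator. *)
Lemma image_exponent_lt y : valid_label p y -> dl p (col_of y) ->
  (image_exponent y (witness_chart y) < gen_exponent (witness_chart y) (col_of y))%N.
Proof.
case: y => [i j c|i j c|i j c] /=; first by case=> _ /negPf->.
  by case=> _ _ ? _; rewrite /image_exponent /gen_exponent /=; lia.
by case=> _ _ ? _; rewrite /image_exponent /gen_exponent /=; lia.
Qed.

Lemma gen_in U l : dl p l -> S U (gmono U l *: 'e_l).
Proof. by move=> dll; apply: fixed_sheaf_delta; apply: component_mono. Qed.

Lemma basis_vec_gen x U i j :
  basis_vec k p x U (gmono U i *: 'e_i) 0 j =
  if [&& acts x U, i == row_of x & j == col_of x]
  then gmono U i * zvar ^ label_exponent p x else 0.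
Proof.
rewrite basis_vecE !mxE eqxx /= [row_of x == i]eq_sym.
by case: (acts x U); case: (j == _) => //=; case: (i == _); rewrite ?mulr1 ?mulr0 ?mul0r.
Qed.

(** To isolate the coefficient of y, evaluate on the row generator on the
    witness chart of y and read the column coordinate. The combination becomes
    a polynomial in the local coordinate; to the exponent of the monomial of y
    no other label contributes, and elements of the fixed sheaf have no term
    of that exponent. *)
Lemma independent (N : nat) (x : 'I_N -> basis_label n) (c : 'I_N -> k) :
  injective x -> (forall l, valid_label p (x l)) ->
  eq_hom S (lincomb c (fun l => basis_vec k p (x l))) (@zero_hom k n) ->
  forall l, c l = 0.
Proof.
move=> xinj hx h l0; set y := x l0; have hy : valid_label p y := hx l0.
set U := witness_chart y; set i := row_of y; set j := col_of y.
have [hay hU] := acts_witness_chart y.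
(* The column coordinate of each basis element on the row generator of y. *)
pose q l : {poly k} := if [&& acts (x l) U, i == row_of (x l) & j == col_of (x l)]
  then 'X^(image_exponent (x l) U) else 0.
have /fixed_sheafP/(_ j) := h U _ (gen_in U (dl_row hy)).
have -> : (lincomb c (fun l => basis_vec k p (x l)) U (gmono U i *: 'e_i)
    - @zero_hom k n U (gmono U i *: 'e_i)) 0 j = leval U (\sum_l c l *: q l).
  rewrite leval_sum /lincomb /zero_hom subr0 summxE; apply: eq_bigr => l _.
  rewrite mxE levalZ basis_vec_gen // /q; congr (_ * _).
  case: ifP => [/and3P[ha /eqP hi _]|_]; last by rewrite leval0.
  by rewrite levalXn hi value_image_exponent.
case=> g /(regularP _ hU) [w ->] e.
have : \sum_l c l *: q l = if dl p j then w * 'X^(gen_exponent U j) else 0.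
  apply/eqP; rewrite -subr_eq0; apply/eqP/(@leval_inj _ U).
  rewrite levalB e; case: ifP => _; last by rewrite leval0 subrr.
  by rewrite levalM levalXn gmonoE subrr.
move/(congr1 (fun v : {poly k} => v`_(image_exponent y U))).
rewrite coef_sum (bigD1 l0) //= big1 => [|l ne].
  rewrite addr0 coefZ {1}/q -/y hay !eqxx coefXn eqxx mulr1 => ->.
  case: ifP => dj; last by rewrite coef0.
  by rewrite coefMXn image_exponent_lt.
rewrite coefZ /q; case: ifP => [/and3P[ha /eqP hi /eqP hj]|_]; last by rewrite coef0 mulr0.
rewrite coefXn; case: eqP => [he|_]; last by rewrite mulr0.
by case/eqP: ne; apply: xinj; apply: image_exponent_inj.
Qed.

End Basis.

(** * The basis homomorphisms span *)

Section Spanning.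
Variables (k : closedFieldType) (n : nat) (p : triple n).
Local Notation K := (ratfun k).
Local Notation zvar := (@zvar k).
Local Notation cst := (@cst k).
Local Notation premor := (premor k n).
Implicit Types (U : chart) (phi psi : premor) (x y : basis_label n).
Local Notation S := (fixed_sheaf k p).
Local Notation gmono U l := (mono k U (ea p l) (eb p l)).
Local Notation "''e_' i" := (delta_mx 0 i : 'rV[K]_n)
  (at level 8, i at level 2, format "''e_' i").

(** When delta_j = 0 the target has no torsion in position j, so the values on
    the two charts agree exactly, not only modulo the sheaf, on the overlap,
    up to the transition function between the generators. *)
Lemma hom_glue phi i j : is_hom S phi -> dl p i -> ~~ dl p j ->
  phi U0 (gmono U0 i *: 'e_i) 0 j
    = zvar ^+ (ea p i + eb p i) * phi Uinf (gmono Uinf i *: 'e_i) 0 j.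
Proof.
move=> [_ h2 h3] di /negPf dj.
have zN0 : zvar ^+ (ea p i + eb p i) != 0 by rewrite expf_neq0 ?zvar_neq0.
have entry0 (m : 'rV[K]_n) : S Uboth m -> m 0 j = 0.
  by move/fixed_sheafP/(_ j) => [g _]; rewrite dj.
have e0 := entry0 _ (h3 _ _ (gen_in k U0 di)).
have einf := entry0 _ (h3 _ _ (gen_in k Uinf di)).
have hR := regular_subring k Uboth; have [S0 _ _] := fixed_sheaf_submodule k p Uboth.
have ephi0 := entry0 _ (h2 Uboth 1 0 0 (subring1 hR) S0 S0).
have gU : S Uboth (gmono U0 i *: 'e_i) by exact: (gen_in k Uboth di).
have rN : regular Uboth (zvar ^- (ea p i + eb p i)) by rewrite exprnN; exact: regular_zvarz.
have eN := entry0 _ (h2 Uboth _ _ 0 rN gU S0).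
move: e0 einf ephi0 eN; rewrite addr0 scalerA -mono_Uinf_U0 scaler0 addr0 scale1r !mxE.
move=> e0 einf ephi0 eN.
have p0 : phi Uboth 0 0 j = 0.
  by move: ephi0; rewrite opprD addrA subrr sub0r => /eqP; rewrite oppr_eq0 => /eqP.
rewrite p0 addr0 in eN.
move/eqP: e0; rewrite subr_eq0 => /eqP <-; move/eqP: einf; rewrite subr_eq0 => /eqP <-.
by move/eqP: eN; rewrite subr_eq0 => /eqP ->; rewrite mulrA mulfV // mul1r.
Qed.

(** The shape of a homomorphism in the summand .E_ij. *)
Definition supported (i j : 'I_n) phi : Prop :=
  forall U (m : 'rV[K]_n) (j' : 'I_n), (j' != j) || (m 0 i == 0) -> phi U m 0 j' = 0.

Lemma supported_add i j phi psi : supported i j phi -> supported i j psi ->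
  supported i j (add_hom phi psi).
Proof. by move=> h g U m j' hj; rewrite /add_hom mxE h // g // addr0. Qed.

Lemma supported_sum i j (I : Type) (r : seq I) (F : I -> premor) :
  (forall l, supported i j (F l)) -> supported i j (fun U m => \sum_(l <- r) F l U m).
Proof. by move=> h U m j' hj; rewrite summxE big1 // => l _; apply: h. Qed.

Lemma supported_basis u x : supported (row_of x) (col_of x) (scale_hom u (basis_vec k p x)).
Proof.
move=> U m j' hj; rewrite /scale_hom mxE basis_vecE.
case/orP: hj => [/negPf ->|/eqP ->]; first by rewrite andbF mulr0.
by rewrite mul0r if_same mulr0.
Qed.

Section Piece.
Variables (F G : 'I_n -> 'I_n -> {poly k}).

(** The expansion of the (i, j) entry of a homomorphism, given the polynomials
    in the local coordinates that represent its values, F on U0 and G at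
    infinity. *)
Definition piece (P : rel 'I_n) i j : premor :=
  if dl p i && P i j then
    if dl p j then
      add_hom
        (fun U m => \sum_(c : 'I_(ea p j))
           scale_hom (F i j)`_c (basis_vec k p (Bzero i j (ea p j - c))) U m)
        (fun U m => \sum_(c : 'I_(eb p j))
           scale_hom (G i j)`_c (basis_vec k p (Binf i j (eb p j - c))) U m)
    else fun U m => \sum_(c : 'I_(ea p i + eb p i).+1)
           scale_hom (F i j)`_c (basis_vec k p (Bfree i j (c%:Z - (ea p i)%:Z))) U m
  else @zero_hom k n.

Definition local_poly U i j : {poly k} := if U is Uinf then G i j else F i j.

Lemma piece_ind (P : rel 'I_n) i j (Q : premor -> Prop) :
  Q (@zero_hom k n) ->
  (forall phi psi, Q phi -> Q psi -> Q (add_hom phi psi)) ->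
  (forall N (f : 'I_N -> premor), (forall c, Q (f c)) -> Q (fun U m => \sum_c f c U m)) ->
  (forall u x, valid_label p x -> P i j -> row_of x = i -> col_of x = j ->
     Q (scale_hom u (basis_vec k p x))) ->
  Q (piece P i j).
Proof.
move=> h0 hD hs hb; rewrite /piece; case: ifP => // /andP[di Pij].
case: ifP => dj.
  by apply: hD; apply: hs => c; apply: hb => //=; split=> //; have := ltn_ord c; lia.
apply: hs => c; apply: hb => //=; rewrite dj; split=> //; have := ltn_ord c; lia.
Qed.

Lemma piece_supported (P : rel 'I_n) i j : supported i j (piece P i j).
Proof.
apply: piece_ind.
- by move=> U m j' _; rewrite mxE.
- exact: supported_add.
- by move=> N f; apply: supported_sum.
- by move=> u x _ _ <- <-; apply: supported_basis.
Qed.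

Lemma piece_hom (P : rel 'I_n) i j : is_hom S (piece P i j).
Proof.
apply: piece_ind.
- exact: is_hom_zero.
- exact: is_hom_add.
- by move=> N f; apply: is_hom_sum.
- by move=> u x hx _ _ _; apply/is_hom_scale/basis_vec_is_hom.
Qed.

Lemma piece_spannable (P : rel 'I_n) i j :
  spannable p (fun x => valid_label p x /\ P (row_of x) (col_of x)) (basis_vec k p) (piece P i j).
Proof.
apply: piece_ind.
- exact: spannable_zero.
- exact: spannable_add.
- by move=> N f; apply: spannable_sum.
- by move=> u x hx hP hr hc; apply: spannable_gen; rewrite hr hc.
Qed.

Lemma piece_value (P : rel 'I_n) i j U : dl p i -> P i j -> dl p j -> U <> Uboth ->
  piece P i j U (gmono U i *: 'e_i) 0 j =
  \sum_(c < gen_exponent p U j) cst (local_poly U i j)`_c * lcoord k U ^+ c.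
Proof.
move=> di Pij dj hU; rewrite /piece di Pij dj /add_hom mxE !summxE.
have vz (c : 'I_(ea p j)) : valid_label p (Bzero i j (ea p j - c)).
  by split=> //; have := ltn_ord c; lia.
have vi (c : 'I_(eb p j)) : valid_label p (Binf i j (eb p j - c)).
  by split=> //; have := ltn_ord c; lia.
case: U hU => // _.
- rewrite [X in _ + X]big1 => [|c _]; last first.
    by rewrite /scale_hom mxE basis_vec_gen // mulr0.
  rewrite addr0; apply: eq_bigr => c _; rewrite /scale_hom mxE basis_vec_gen // !eqxx /=.
  rewrite (value_image_exponent k (vz c)) //; congr (_ * _ ^+ _).
  by have := ltn_ord c; rewrite /image_exponent /=; lia.
- rewrite [X in X + _]big1 => [|c _]; last first.
    by rewrite /scale_hom mxE basis_vec_gen // mulr0.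
  rewrite add0r; apply: eq_bigr => c _; rewrite /scale_hom mxE basis_vec_gen // !eqxx /=.
  rewrite (value_image_exponent k (vi c)) //; congr (_ * _ ^+ _).
  by have := ltn_ord c; rewrite /image_exponent /=; lia.
Qed.

Lemma piece_value_free (P : rel 'I_n) i j U :
  dl p i -> P i j -> ~~ dl p j -> (size (F i j) <= (ea p i + eb p i).+1)%N ->
  piece P i j U (gmono U i *: 'e_i) 0 j
    = gmono U i * zvar ^ (- (ea p i)%:Z) * leval U0 (F i j).
Proof.
move=> di Pij dj hF; rewrite /piece di Pij (negPf dj) summxE (leval_coef _ hF) mulr_sumr.
apply: eq_bigr => c _; rewrite /scale_hom mxE basis_vec_gen.
rewrite !eqxx /= addrC expfzDr ?zvar_neq0 // exprnP.
by rewrite [LHS]mulrCA -[RHS]mulrA [in RHS](mulrCA (zvar ^ _)).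
Qed.

End Piece.

(** On each affine chart, the value of phi on a generator has polynomial
    coordinates. If delta_j = 1 they matter modulo the power of the local
    coordinate that generates the column summand, and the truncations on the
    two charts are independent, because the quotient vanishes on the overlap.
    If delta_j = 0, the two charts are linked by [hom_glue], which makes the
    entry a section of O(a_i + b_i). In both cases the remaining coefficients
    are those of [piece]. *)
Lemma spanning (P : rel 'I_n) phi : block p P phi ->
  spannable p (fun x => valid_label p x /\ P (row_of x) (col_of x)) (basis_vec k p) phi.
Proof.
move=> [hphi hP]; have [h1 _ h3] := hphi.
have coefs U : U <> Uboth -> exists w : 'I_n * 'I_n -> {poly k}, forall ij, dl p ij.1 ->
    phi U (gmono U ij.1 *: 'e_(ij.1)) 0 ij.2 = leval U (w ij).
  move=> hU; apply: (@fin_all_exists _ (fun=> {poly k}) (fun ij w => dl p ij.1 ->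
    phi U (gmono U ij.1 *: 'e_(ij.1)) 0 ij.2 = leval U w)) => -[i j] /=.
  have [di|_] := boolP (dl p i); last by exists 0.
  have /(regularP _ hU) [w hw] := h1 U _ (gen_in k U di) j.
  by exists w.
have [f hf] : exists f, forall i j, dl p i ->
    phi U0 (gmono U0 i *: 'e_i) 0 j = leval U0 (f i j).
  by have [//|w hw] := coefs U0; exists (fun i j => w (i, j)) => i j; apply: (hw (i, j)).
have [g hg] : exists g, forall i j, dl p i ->
    phi Uinf (gmono Uinf i *: 'e_i) 0 j = leval Uinf (g i j).
  by have [//|w hw] := coefs Uinf; exists (fun i j => w (i, j)) => i j; apply: (hw (i, j)).
pose psi : premor := fun U m => \sum_i \sum_j piece f g P i j U m.
have psi_hom : is_hom S psi.
  by apply: is_hom_sum => i; apply: is_hom_sum => j; apply: piece_hom.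
have psi_gen U i j : psi U (gmono U i *: 'e_i) 0 j = piece f g P i j U (gmono U i *: 'e_i) 0 j.
  rewrite /psi summxE (bigD1 i) //= summxE (bigD1 j) //= !big1 ?addr0 //.
    move=> i' ne; rewrite summxE big1 // => j' _; apply: piece_supported.
    by rewrite !mxE eqxx (negPf ne) mulr0 eqxx orbT.
  by move=> j' ne; apply: piece_supported; rewrite eq_sym ne.
apply: (@spannable_eq _ _ _ _ _ _ _ psi); last first.
  by apply: spannable_sum => i; apply: spannable_sum => j; apply: piece_spannable.
have eq_local U : U <> Uboth -> forall m, S U m -> S U (phi U m - psi U m).
  move=> hU; apply: hom_eq_gens => // i di.
  rewrite -[mono_vec _ _ _]/(gmono U i *: 'e_i); apply/fixed_sheafP => j.
  rewrite mxE [X in _ + X]mxE psi_gen.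
  have [Pij|nP] := boolP (P i j); last first.
    rewrite {1}/piece (negPf nP) andbF /zero_hom mxE subr0.
    have off l : l != i -> (gmono U i *: 'e_i) (0 : 'I_1) l = 0.
      by move=> li; rewrite !mxE eqxx (negPf li) mulr0.
    have /fixed_sheafP/(_ j) := hP i j nP U _ (gen_in k U di) off.
    by rewrite !mxE !eqxx mulr1.
  have [dj|dj] := boolP (dl p j).
    rewrite piece_value //.
    set w := local_poly f g U i j.
    have -> : phi U (gmono U i *: 'e_i) 0 j = leval U w.
      by rewrite /w; case: U hU @w => //= _; [exact: hf|exact: hg].
    rewrite (leval_split U w (gen_exponent p U j)) addrAC subrr add0r.
    exists (leval U (drop_poly (gen_exponent p U j) w)); last by rewrite dj gmonoE.
    by apply/regularP => //; eexists.
  have glue := hom_glue hphi di dj; rewrite hf // hg // in glue.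
  (* The size bound is what makes the finite expansion of [piece] exhaust f. *)
  have hs := degree_bound glue.
  rewrite piece_value_free //; exists 0; first exact: (subring0 (regular_subring k U)).
  rewrite (negPf dj); apply/eqP; rewrite subr_eq0; apply/eqP.
  have z0 := zvar_neq0 k; case: U hU => // _.
    by rewrite hf // monoU0 -expfzDr // subrr expr0z mul1r.
  rewrite hg // monoUinf -expfzDr // glue mulrA exprnP -expfzDr //.
  by rewrite (_ : _ + _ = 0) ?expr0z ?mul1r //; lia.
move=> U m hm; have [_ _ g3] := psi_hom.
case: U hm => hm; [exact: (eq_local U0 _ _ hm)|exact: (eq_local Uinf _ _ hm)|].
(* The overlap is covered by U0: both have the same generators x^a_i e_i. *)
apply: hom_eq_gens hm => // i di.
rewrite -[mono_vec _ _ _]/(gmono U0 i *: 'e_i).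
have hgen := gen_in k U0 di.
have sub : S Uboth (phi U0 (gmono U0 i *: 'e_i) - psi U0 (gmono U0 i *: 'e_i)).
  have /fixed_sheafP h0 := eq_local U0 ltac:(by []) _ hgen.
  apply/fixed_sheafP => l; have [w hw ->] := h0 l; exists w => //.
  exact: (@regular_Uboth _ U0).
have [_ hD _] := fixed_sheaf_submodule k p Uboth.
have := fixed_sheafB (hD _ _ (h3 U0 _ hgen) sub) (g3 U0 _ hgen).
by congr (S _ _); apply/rowP => l; rewrite !mxE; ring.
Qed.

End Spanning.

(** * Bases and weights *)

Lemma weight_shuffle (R : comNzRingType) (a b m q z : R) :
  a * (b * m * (q * z)) = a * b * q * (m * z).
Proof. by ring. Qed.

Section Labels.
Variables (k : closedFieldType) (n : nat).
Local Notation K := (ratfun k).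
Local Notation zvar := (@zvar k).
Local Notation cst := (@cst k).
Local Notation premor := (premor k n).
Implicit Types (U : chart) (p : triple n) (C : curve n) (phi psi : premor) (x y : basis_label n).
Local Notation "''e_' i" := (delta_mx 0 i : 'rV[_]_n)
  (at level 8, i at level 2, format "''e_' i").

Lemma is_basis_block p (P : rel 'I_n) :
  is_basis (fixed_sheaf k p) (block p P)
    (fun x => valid_label p x /\ P (row_of x) (col_of x)) (basis_vec k p).
Proof.
split=> [x [hx hP]|N x c xinj hx|phi]; last exact: spanning.
  split=> [|i j nP U m hm hi]; first exact: basis_vec_is_hom.
  rewrite basis_vecE; have [S0 _ _] := fixed_sheaf_submodule k p U.
  case: ifP => [/andP[_ /eqP ej]|_]; last by rewrite scale0r.
  rewrite hi ?mul0r ?scale0r //; apply: contraNneq nP => ei.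
  by rewrite -ei ej.
by apply: independent => // l; case: (hx l).
Qed.

Lemma is_basis_hom p :
  is_basis (fixed_sheaf k p) (is_hom (fixed_sheaf k p)) (valid_label p) (basis_vec k p).
Proof.
split=> [x hx|N x c xinj hx|phi hphi]; first exact: basis_vec_is_hom.
  exact: independent.
have [//|N [x [c [hx hc]]]] := @spanning k n p (fun _ _ => true) phi.
by exists N, x, c; split=> // l; case: (hx l).
Qed.

Lemma char_valD (g : torus k n) (chi chi' : character n) : torus_pt g ->
  char_val (chi + chi') g = char_val chi g * char_val chi' g.
Proof.
move=> [hD q0]; rewrite /char_val mulrACA -big_split /= expfzDr //; congr (_ * _).
by apply: eq_bigr => i _; rewrite mxE expfzDr.
Qed.

Lemma char_val_e (g : torus k n) i : char_val (wt_e i) g = tdiag g i.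
Proof.
rewrite /char_val /= expr0z mulr1 (bigD1 i) //= big1 => [|l /negPf li].
  by rewrite mxE !eqxx mulr1 expr1z.
by rewrite mxE eqxx li expr0z.
Qed.

Lemma char_valN (g : torus k n) (chi : character n) : torus_pt g ->
  char_val (- chi) g = (char_val chi g)^-1.
Proof.
move=> [hD q0]; rewrite /char_val invfM /= invr_expz; congr (_ * _).
by rewrite -prodfV; apply: eq_bigr => i _; rewrite mxE invr_expz.
Qed.

Lemma char_val_f (g : torus k n) (e : int) : char_val (wt_f *~ e) g = tq g ^ e.
Proof.
have -> : wt_f *~ e = ((0, e) : character n).
  rewrite [LHS]surjective_pairing; congr (_, _).
    by rewrite (raddfMz (@fst _ _)) /= mul0rz.
  by rewrite (raddfMz (@snd _ _)) /= intz.
by rewrite /char_val /= big1 ?mul1r // => l _; rewrite mxE expr0z.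
Qed.

Lemma basis_vec_weight p x : valid_label p x ->
  has_weight (fixed_sheaf k p) (basis_vec k p x) (label_weight p x).
Proof.
move=> hx g hg U m hm; have [hD q0] := hg.
suff -> : act_hom g (basis_vec k p x) U m
    = scale_hom (char_val (label_weight p x) g) (basis_vec k p x) U m.
  by rewrite subrr; case: (fixed_sheaf_submodule k p U).
rewrite /label_weight !char_valD // char_valN // !char_val_e char_val_f.
apply/rowP => j; rewrite /act_hom /scale_hom !mxE !basis_vecE.
case: ifP => [/andP[_ /eqP ->]|_]; last by rewrite dilate0 // !mulr0.
rewrite !mxE ffunE /= (dilateM q0 (cst _ * _)) (dilateM q0 (cst _)) dilate_cst // dilateK //.
rewrite dilateXz // dilate_zvar // exprMz_comm ?unitfE ?cst_eq0 ?zvar_neq0 //; last exact: mulrC.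
by rewrite !cstM cstXz; apply: weight_shuffle.
Qed.

Lemma has_weight_eq p phi psi chi : eq_hom (fixed_sheaf k p) phi psi ->
  has_weight (fixed_sheaf k p) psi chi -> has_weight (fixed_sheaf k p) phi chi.
Proof.
move=> e h g hg U m hm.
have hm' : fixed_sheaf k p U (act_vec (tinv g) m).
  by apply: act_fixed => //; exact: torus_pt_inv.
have [_ hDd hZ] := fixed_sheaf_submodule k p U.
have h1 := act_fixed hg (e U _ hm'); rewrite act_vecB // in h1.
have h2 := hZ _ _ (regular_cst U (char_val chi g)) (e U _ hm); rewrite scalerBr in h2.
have := fixed_sheafB (hDd _ _ h1 (h g hg U m hm)) h2.
rewrite /act_hom /scale_hom; congr (fixed_sheaf _ _ _ _).
by apply/rowP => l; rewrite !mxE; ring.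
Qed.

End Labels.

(** * Tangent vectors of the curves *)

Section Velocity.
Variables (k : closedFieldType) (n : nat).
Local Notation K := (ratfun k).
Local Notation zvar := (@zvar k).
Local Notation cst := (@cst k).
Local Notation premor := (premor k n).
Implicit Types (U : chart) (p : triple n) (C : curve n) (phi psi : premor) (x y : basis_label n).
Local Notation "''e_' i" := (delta_mx 0 i : 'rV[_]_n)
  (at level 8, i at level 2, format "''e_' i").

Lemma velocity_unique p (F : tfamily k n) phi psi :
  velocity (fixed_sheaf k p) F phi -> velocity (fixed_sheaf k p) F psi ->
  eq_hom (fixed_sheaf k p) phi psi.
Proof.
move=> [[h1 _ _] hphi] [_ hpsi] U m hm.
have /hphi/hpsi [] // : deformation (fixed_sheaf k p) phi U m (phi U m).
split=> // [j|]; first exact: h1.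
by rewrite subrr; case: (fixed_sheaf_submodule k p U).
Qed.

Definition regular_poly U (f : {poly K}) : Prop := forall e, regular U f`_e.

Lemma regular_poly_subring U : subring (regular_poly U).
Proof.
have hR := regular_subring k U; split.
- by move=> e; rewrite coef1; case: (e == 0%N); [exact: subring1 hR|exact: subring0 hR].
- by move=> f g hf hg e; rewrite coefB; apply: (subringB hR).
- move=> f g hf hg e; rewrite coefM; apply: (subring_sum hR) => l _.
  exact: (subringM hR).
Qed.

Lemma regular_polyC U f : regular U f -> regular_poly U f%:P.
Proof.
move=> hf e; rewrite coefC; case: ifP => // _.
exact: (subring0 (regular_subring k U)).
Qed.

Lemma regular_polyX U : regular_poly U 'X.
Proof.
move=> e; rewrite coefX; have hR := regular_subring k U.
by case: (e == 1%N); [exact: subring1 hR|exact: subring0 hR].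
Qed.

Lemma coefp0Z (f : {poly K}) (M : 'rV[{poly K}]_n) :
  map_mx (coefp 0%N) (f *: M) = f`_0 *: map_mx (coefp 0%N) M.
Proof. by apply/rowP => l; rewrite !mxE /= coef0M. Qed.

Lemma coefp1Z (f : {poly K}) (M : 'rV[{poly K}]_n) :
  map_mx (coefp 1%N) (f *: M)
    = f`_0 *: map_mx (coefp 1%N) M + f`_1 *: map_mx (coefp 0%N) M.
Proof.
by apply/rowP => l; rewrite !mxE /= coefM !big_ord_recl big_ord0 /= addr0.
Qed.

Definition pencil_velocity p C U : 'rV[K]_n :=
  let h := curve_pencil p C in mono k U (pc_a' h) (pc_b' h) *: 'e_(pc_j h).

Definition pencil_base p C U : 'rV[K]_n :=
  let h := curve_pencil p C in mono k U (pc_a h) (pc_b h) *: 'e_(pc_i h).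

Lemma point_vec10 p C U : point_vec p C 1 0 U = pencil_base p C U.
Proof. by rewrite /point_vec /pencil_vec cst1 cst0 !mul0r scale0r addr0 mul1r. Qed.

Lemma mono_vec_poly U (m : monomial n) :
  mono_vec (xcoord U)%:P (ycoord U)%:P m
  = map_mx polyC (mono_vec (xcoord U) (ycoord U) m : 'rV[K]_n).
Proof.
apply/rowP => l; rewrite !mxE polyCM polyCM polyC_exp polyC_exp.
by congr (_ * _); rewrite rmorph_nat.
Qed.

Lemma pencil_vec_poly p C U :
  pencil_vec (curve_pencil p C) (xcoord U)%:P (ycoord U)%:P 1 'X
  = map_mx polyC (pencil_base p C U) + 'X *: map_mx polyC (pencil_velocity p C U).
Proof.
have E a b l : ((xcoord U)%:P ^+ a * (ycoord U)%:P ^+ b) *: 'e_l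
    = map_mx polyC (mono k U a b *: 'e_l) := mono_vec_poly U (l, a, b).
by rewrite /pencil_vec mul1r -['X * _ * _]mulrA -['X * (_ * _) *: _]scalerA !E.
Qed.

Lemma coefp_polyC0 (m : 'rV[K]_n) : map_mx (coefp 0%N) (map_mx polyC m) = m.
Proof. by apply/rowP => l; rewrite !mxE /= coefC. Qed.
Lemma coefp_polyC1 (m : 'rV[K]_n) : map_mx (coefp 1%N) (map_mx polyC m) = 0.
Proof. by apply/rowP => l; rewrite !mxE /= coefC. Qed.

Lemma coefp0_addX (A B : 'rV[{poly K}]_n) :
  map_mx (coefp 0%N) (A + 'X *: B) = map_mx (coefp 0%N) A.
Proof. by apply/rowP => l; rewrite !mxE /= coefD coefXM addr0. Qed.

Lemma coefp1_addX (A B : 'rV[{poly K}]_n) :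
  map_mx (coefp 1%N) (A + 'X *: B) = map_mx (coefp 1%N) A + map_mx (coefp 0%N) B.
Proof. by apply/rowP => l; rewrite !mxE /= coefD coefXM. Qed.

Lemma coefp0_pencil (A B : 'rV[K]_n) :
  map_mx (coefp 0%N) (map_mx polyC A + 'X *: map_mx polyC B) = A.
Proof. by rewrite coefp0_addX coefp_polyC0. Qed.

Lemma coefp1_pencil (A B : 'rV[K]_n) :
  map_mx (coefp 1%N) (map_mx polyC A + 'X *: map_mx polyC B) = B.
Proof. by rewrite coefp1_addX coefp_polyC0 coefp_polyC1 add0r. Qed.

(** Multiplying by t shows that every section of the fixed sheaf is the
    coefficient of t in some lift of zero. By linearity, the restriction of
    the family to first order is then determined by the coefficient of t in
    one lift of each generator, and phi describes it as soon as it agrees with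
    these coefficients modulo the fixed sheaf. *)
Lemma velocityP d r p C phi : in_F d r p -> valid_curve d r p C ->
  is_hom (fixed_sheaf k p) phi ->
  (forall U c m m', phi U (c *: m + m') = c *: phi U m + phi U m') ->
  (forall U, fixed_sheaf k p U (pencil_velocity p C U - phi U (pencil_base p C U))) ->
  (forall U m, m \in curve_monos p C ->
     fixed_sheaf k p U (phi U (mono_vec (xcoord U) (ycoord U) m))) ->
  velocity (fixed_sheaf k p) (curve_family p C) phi.
Proof.
move=> hp hv hphi plin hpen hmono; split=> // U m0 m1.
have [h1 _ _] := hphi.
have hR := regular_subring k U; have hRp := regular_poly_subring U.
have hS := fixed_sheaf_submodule k p U; have [S0 SD SZ] := hS.
have hF : submodule (regular_poly U) (curve_family p C U) by exact: seq_span_submodule.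
have [F0 FD FZ] := hF.
have phiD m m' : phi U (m + m') = phi U m + phi U m'.
  by rewrite -[m in LHS]scale1r plin scale1r.
have phi0 : phi U 0 = 0.
  have /eqP := phiD 0 0.
  by rewrite addr0 -subr_eq0 opprD addrA subrr sub0r oppr_eq0 => /eqP.
have phiZ c m : phi U (c *: m) = c *: phi U m by rewrite -[c *: m]addr0 plin phi0 addr0.
have F_pencil : curve_family p C U
    (map_mx polyC (pencil_base p C U) + 'X *: map_mx polyC (pencil_velocity p C U)).
  apply: seq_span_mem; first exact: hRp.
  by rewrite mem_curve_gens -pencil_vec_poly mem_head.
have F_mono m : m \in curve_monos p C ->
    curve_family p C U (map_mx polyC (mono_vec (xcoord U) (ycoord U) m : 'rV[K]_n)).
  move=> hm; apply: seq_span_mem; first exact: hRp.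
  by rewrite mem_curve_gens -mono_vec_poly inE map_f ?orbT.
have base_in : fixed_sheaf k p U (pencil_base p C U).
  by rewrite -point_vec10; apply/(curve_value_start hp hv (oner_neq0 _)); exact: curve_value_pencil.
have mono_in m : m \in curve_monos p C -> fixed_sheaf k p U (mono_vec (xcoord U) (ycoord U) m).
  by move=> hm; apply/(curve_value_start hp hv (oner_neq0 _)); exact: curve_value_mono.
have reg_base m : fixed_sheaf k p U m -> forall j, regular U (m 0 j).
  by move=> hm j; apply: fixed_sheaf_regular hm.
split.
- move=> [M hM [<- <-]]; move: M hM; apply: (seq_span_min (S := fun M =>
    deformation (fixed_sheaf k p) phi U (map_mx (coefp 0%N) M) (map_mx (coefp 1%N) M))).
    split.
    + by rewrite !raddf0; split=> // [j|]; [rewrite mxE; exact: subring0 hR|rewrite phi0 subr0].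
    + move=> M M' [e1 e2 e3] [e1' e2' e3']; rewrite !raddfD /=; split; first exact: SD.
        by move=> j; rewrite mxE; apply: (subringD hR); [exact: e2|exact: e2'].
      by rewrite phiD opprD addrACA; apply: SD.
    + move=> f M hf [e1 e2 e3]; rewrite coefp0Z coefp1Z; split; first exact: SZ.
        move=> j; rewrite !mxE; apply: (subringD hR); apply: (subringM hR) => //.
          by have := e2 j; rewrite mxE.
        by have := reg_base _ e1 j; rewrite mxE.
      by rewrite phiZ addrAC -scalerBr; apply: SD; apply: SZ.
  move=> g; rewrite mem_curve_gens inE pencil_vec_poly => /orP[/eqP ->|/mapP [m hm ->]].
    rewrite [X in deformation _ _ _ _ X]coefp1_pencil [X in deformation _ _ _ X _]coefp0_pencil.
    split; [exact: base_in| |exact: hpen] => j.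
    rewrite !mxE; apply: (subringM hR); first exact: regular_mono.
    by case: (_ && _); [exact: subring1 hR|exact: subring0 hR].
  rewrite mono_vec_poly [X in deformation _ _ _ _ X]coefp_polyC1.
  rewrite [X in deformation _ _ _ X _]coefp_polyC0; split; first exact: mono_in.
    by move=> j; rewrite mxE; exact: subring0 hR.
  by rewrite sub0r -scaleN1r; apply: SZ; [apply: (subringN hR); exact: subring1 hR|exact: hmono].
- move=> [hm0 hm1 hd].
  have lift m : fixed_sheaf k p U m -> exists2 M, curve_family p C U M &
      map_mx (coefp 0%N) M = m /\ fixed_sheaf k p U (map_mx (coefp 1%N) M - phi U m).
    move/(curve_value_start hp hv (oner_neq0 _)).
    apply: (curve_value_min (S := fun m => exists2 M, curve_family p C U M &
      map_mx (coefp 0%N) M = m /\ fixed_sheaf k p U (map_mx (coefp 1%N) M - phi U m))).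
    + split.
      * by exists 0 => //; rewrite !raddf0 phi0 subr0.
      * move=> v w [M hM [<- e]] [M' hM' [<- e']]; exists (M + M'); first exact: FD.
        by rewrite !raddfD /= phiD opprD addrACA; split=> //; apply: SD.
      * move=> c v hc [M hM [<- e]]; exists (c%:P *: M).
          by apply: FZ => //; exact: regular_polyC.
        rewrite coefp0Z coefp1Z !coefC /= scale0r addr0 phiZ -scalerBr.
        by split=> //; apply: SZ.
    + rewrite point_vec10; exists (map_mx polyC (pencil_base p C U)
        + 'X *: map_mx polyC (pencil_velocity p C U)) => //.
      by split; [exact: coefp0_pencil|rewrite coefp1_pencil; exact: hpen].
    + move=> m' hm'; exists (map_mx polyC (mono_vec (xcoord U) (ycoord U) m' : 'rV[K]_n)).
        exact: F_mono.
      split; first exact: coefp_polyC0.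
      rewrite coefp_polyC1 sub0r -scaleN1r.
      by apply: SZ; [apply: (subringN hR); exact: subring1 hR|exact: hmono].
  have [M hM [eM0 eM1]] := lift _ hm0.
  have hrest : fixed_sheaf k p U (m1 - map_mx (coefp 1%N) M).
    have := fixed_sheafB hd eM1; congr (fixed_sheaf _ _ _ _).
    by rewrite opprB addrA subrK.
  (* Multiplied by t, a lift of the difference corrects the coefficient of t. *)
  have [M' hM' [eM0' _]] := lift _ hrest.
  exists (M + 'X *: M'); first by apply: FD => //; apply: FZ => //; exact: regular_polyX.
  by split; [rewrite coefp0_addX|rewrite coefp1_addX eM0' addrC subrK].
Qed.

End Velocity.

(** * Curves and labels *)

Section LabelOf.
Variable n : nat.
Implicit Types (p : triple n) (C : curve n) (x y : basis_label n).

(** The exponents are chosen so that the basis element takes the base term of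
    the moving generator to its t term; see [velocity_pencil]. *)
Definition label_of p C : basis_label n :=
  match C with
  | CurveI i j p' => Bfree i j ((ea p' j)%:Z - (ea p i)%:Z)
  | CurveIIa i j p' => Bzero i j (ea p j - ea p' j)
  | CurveIIb i j p' => Binf i j (eb p j - eb p' j)
  | CurveIII i p' =>
      if (ea p' i < ea p i)%N then Bzero i i (ea p i - ea p' i)
      else Binf i i (eb p i - eb p' i)
  end.

Lemma label_of_valid d r p C : in_F d r p -> valid_curve d r p C -> valid_label p (label_of p C).
Proof.
move=> hp /(valid_curveP hp) [] {C} /=.
- by move=> i j p' _ _ _ di _ dj _ _ e; split=> //; lia.
- by move=> i j p' _ _ _ di dj _ _ lt e; split=> //; lia.
- by move=> i j p' _ _ _ di dj _ _ lt e; split=> //; lia.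
- by move=> i p' _ _ di _ na e; case: ifP => h /=; split=> //; lia.
Qed.

Lemma typeI_label d r p C : in_F d r p -> valid_curve d r p C ->
  typeI C = blockI p (row_of (label_of p C)) (col_of (label_of p C)).
Proof.
move=> hp /(valid_curveP hp) [] {C}; rewrite /blockI /=.
- by move=> i j p' _ _ _ -> _ ->.
- by move=> i j p' _ _ _ -> ->.
- by move=> i j p' _ _ _ -> ->.
- by move=> i p' _ _ di _ _ _; case: ifP => _ /=; rewrite di.
Qed.

Lemma typeII_label d r p C : in_F d r p -> valid_curve d r p C ->
  typeII C = blockII p (row_of (label_of p C)) (col_of (label_of p C)).
Proof.
move=> hp /(valid_curveP hp) [] {C}; rewrite /blockII /=.
- by move=> i j p' _ _ _ -> _ /negPf ->.
- by move=> i j p' _ _ -> -> ->.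
- by move=> i j p' _ _ -> -> ->.
- by move=> i p' _ _ di _ _ _; case: ifP => _ /=; rewrite eqxx !andbF.
Qed.

Lemma typeIII_label d r p C : in_F d r p -> valid_curve d r p C ->
  typeIII C = blockIII p (row_of (label_of p C)) (col_of (label_of p C)).
Proof.
move=> hp /(valid_curveP hp) [] {C}; rewrite /blockIII /=.
- by move=> i j p' _ _ _ -> _ /negPf ->.
- by move=> i j p' _ _ /negPf -> -> ->.
- by move=> i j p' _ _ /negPf -> -> ->.
- by move=> i p' _ _ di _ _ _; case: ifP => _ /=; rewrite eqxx di.
Qed.

Lemma triple_ext_off p p' p'' (A : pred 'I_n) : agree_off A p p' -> agree_off A p p'' ->
  (forall l, A l -> [/\ dl p' l = dl p'' l, ea p' l = ea p'' l & eb p' l = eb p'' l]) ->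
  p' = p''.
Proof.
move=> h h' hA; apply: triple_ext => l; have [/hA //|nA] := boolP (A l).
by have [<- <- <-] := h l nA; have [<- <- <-] := h' l nA.
Qed.

Lemma label_of_inj d r p C C' : in_F d r p -> valid_curve d r p C -> valid_curve d r p C' ->
  label_of p C = label_of p C' -> C = C'.
Proof.
move=> hp /(valid_curveP hp) hC /(valid_curveP hp) hC'.
case: hC => {C}.
- move=> i j p' _ hA ij di dj' dj di' [_ _ ai' bi'] e; case: hC' => {C'} //=; last first.
    by move=> i2 p2 _ _ _ _ _ _; case: ifP.
  move=> i2 j2 p2 _ hA2 _ _ dj2' _ di2' [_ _ ai2 bi2] e2 [ei ej]; subst i2 j2 => ec.
  congr CurveI; apply: triple_ext_off hA hA2 _ => l /orP[] /eqP ->.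
    by rewrite (negPf di') (negPf di2') ai' bi' ai2 bi2.
  by rewrite dj' dj2'; split=> //; lia.
- move=> i j p' _ hA ij di dj ed eb lt e; case: hC' => {C'} //=; last first.
    move=> i2 p2 _ _ _ _ _ _; case: ifP => // _ [ei ej]; subst.
    by rewrite eqxx in ij.
  move=> i2 j2 p2 _ hA2 _ _ _ ed2 eb2 lt2 e2 [ei ej]; subst i2 j2 => ec.
  by congr CurveIIa; apply: triple_ext_off hA hA2 _ => l /orP[] /eqP ->;
    rewrite -ed -ed2 -eb -eb2; split=> //; lia.
- move=> i j p' _ hA ij di dj ed ea lt e; case: hC' => {C'} //=; last first.
    move=> i2 p2 _ _ _ _ _ _; case: ifP => // _ [ei ej]; subst.
    by rewrite eqxx in ij.
  move=> i2 j2 p2 _ hA2 _ _ _ ed2 ea2 lt2 e2 [ei ej]; subst i2 j2 => ec.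
  by congr CurveIIb; apply: triple_ext_off hA hA2 _ => l /orP[] /eqP ->;
    rewrite -ed -ed2 -ea -ea2; split=> //; lia.
- move=> i p' _ hA di ed na e; case: hC' => {C'} /=.
  + by move=> i2 j2 p2 _ _ _ _ _ _ _ _ _; case: ifP => _.
  + move=> i2 j2 p2 _ _ ij _ _ _ _ _ _; case: ifP => // _ [ei ej]; subst.
    by rewrite eqxx in ij.
  + move=> i2 j2 p2 _ _ ij _ _ _ _ _ _; case: ifP => // _ [ei ej]; subst.
    by rewrite eqxx in ij.
  + move=> i2 p2 _ hA2 _ ed2 na2 e2 h.
    have ei : i = i2 by move: h; case: ifP => _; case: ifP => _ // [].
    subst i2; congr CurveIII; apply: triple_ext_off hA hA2 _ => l /eqP ->.
    rewrite -ed -ed2; move: h; case: ifP => h1; case: ifP => h2 //; case=> h3; split=> //; lia.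
Qed.

Definition update2 (T : Type) (f : {ffun 'I_n -> T}) i u j v : {ffun 'I_n -> T} :=
  [ffun l => if l == i then u else if l == j then v else f l].

Lemma update2_i T (f : {ffun 'I_n -> T}) i u j v : update2 f i u j v i = u.
Proof. by rewrite ffunE eqxx. Qed.
Lemma update2_j T (f : {ffun 'I_n -> T}) i u j v : i != j -> update2 f i u j v j = v.
Proof. by rewrite ffunE eq_sym => /negPf ->; rewrite eqxx. Qed.
Lemma update2_off T (f : {ffun 'I_n -> T}) i u j v l :
  l != i -> l != j -> update2 f i u j v l = f l.
Proof. by rewrite ffunE => /negPf -> /negPf ->. Qed.
Lemma update2_id T (f : {ffun 'I_n -> T}) i j : update2 f i (f i) j (f j) = f.
Proof. by apply/ffunP => l; rewrite ffunE; case: eqP => [->//|_]; case: eqP => [->|]. Qed.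

(** The other end of a curve. Type III changes one position only, and is the
    case i = j. *)
Definition modify p i j di ai bi dj aj bj : triple n :=
  Triple (update2 (dl p) i di j dj) (update2 (ea p) i ai j aj) (update2 (eb p) i bi j bj).

Lemma sum_agree (f g : 'I_n -> nat) (A : pred 'I_n) :
  (forall l, ~~ A l -> f l = g l) -> (\sum_(l | A l) f l = \sum_(l | A l) g l)%N ->
  (\sum_l f l = \sum_l g l)%N.
Proof.
move=> h e; rewrite (bigID A) [in RHS](bigID A) /= e; congr (_ + _)%N.
exact: eq_bigr.
Qed.

Lemma modify_valid d r p i j (di : bool) ai bi (dj : bool) aj bj : in_F d r p -> i != j ->
  (dl p i + dl p j = di + dj)%N ->
  (ea p i + eb p i + (ea p j + eb p j) = ai + bi + (aj + bj))%N ->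
  (~~ di -> ai = 0 /\ bi = 0)%N -> (~~ dj -> aj = 0 /\ bj = 0)%N ->
  in_F d r (modify p i j di ai bi dj aj bj)
  /\ agree_off (pred2 i j) p (modify p i j di ai bi dj aj bj).
Proof.
move=> [h1 h2 h3] ij e1 e2 hi hj; split; last first.
  by move=> l; rewrite negb_or => /andP[li lj]; rewrite /= !update2_off.
split.
- rewrite -h1; apply: (@sum_agree _ _ (pred2 i j)).
    by move=> l; rewrite negb_or => /andP[li lj] /=; rewrite update2_off.
  by rewrite !sum_pred2 // !update2_i !update2_j.
- rewrite -h2; apply: (@sum_agree _ _ (pred2 i j)).
    by move=> l; rewrite negb_or => /andP[li lj] /=; rewrite !update2_off.
  by rewrite !sum_pred2 // !update2_i !update2_j.
- move=> l /=; have [->|li] := eqVneq l i; first by rewrite !update2_i.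
  have [->|lj] := eqVneq l j; first by rewrite !update2_j.
  by rewrite !update2_off //; exact: h3.
Qed.

Lemma modify1_valid d r p i ai bi : in_F d r p -> dl p i ->
  (ea p i + eb p i = ai + bi)%N ->
  let p' := modify p i i true ai bi true ai bi in
  [/\ in_F d r p', dl p = dl p' & agree_off (pred1 i) p p'].
Proof.
move=> [h1 h2 h3] di e p'; have ed : dl p = dl p'.
  by apply/ffunP => l; rewrite ffunE; case: eqP => [->|].
have hA : agree_off (pred1 i) p p' by move=> l /= li; rewrite /= !update2_off.
split=> //; split; first by rewrite -ed.
  rewrite -h2; apply: (@sum_agree _ _ (pred1 i)); first by move=> l /hA [_ -> ->].
  by rewrite !big_pred1_eq /= !update2_i.
move=> l; rewrite -ed; have [->|li] := eqVneq l i; first by rewrite di.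
by have [_ <- <-] := hA l li; exact: h3.
Qed.

Lemma label_of_surj d r p x : in_F d r p -> valid_label p x ->
  exists C, valid_curve d r p C /\ label_of p C = x.
Proof.
move=> hp; have [_ _ h0] := hp; case: x => [i j c|i j c|i j c] /=.
- move=> [di dj c1 c2]; have ij : i != j by apply: contraNneq dj => <-.
  have [aj bj] := h0 _ dj.
  pose p' := modify p i j false 0 0 true `|(ea p i)%:Z + c| `|(eb p i)%:Z - c|.
  have [hp' hA] : in_F d r p' /\ agree_off (pred2 i j) p p'.
    by apply: modify_valid => //; rewrite ?di ?(negPf dj) // aj bj; lia.
  exists (CurveI i j p'); split; last by rewrite /= update2_j //; congr Bfree; lia.
  by split=> //; split; rewrite // /= ?update2_i ?update2_j.
- move=> [di dj hc]; have [ij|ij] := eqVneq i j.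
    subst j; pose p' := modify p i i true (ea p i - c) (eb p i + c) true (ea p i - c) (eb p i + c).
    have [hp' ed hA] : [/\ in_F d r p', dl p = dl p' & agree_off (pred1 i) p p'].
      by apply: modify1_valid => //; lia.
    exists (CurveIII i p'); split; last first.
      by rewrite /= update2_i ifT; [congr Bzero; lia|lia].
    split=> //; split=> //.
    by move/(congr1 (fun q => ea q i)); rewrite /= update2_i; lia.
  pose p' := modify p i j true (ea p i + c) (eb p i) true (ea p j - c) (eb p j).
  have [hp' hA] : in_F d r p' /\ agree_off (pred2 i j) p p'.
    by apply: modify_valid => //; rewrite ?di ?dj //; lia.
  exists (CurveIIa i j p'); split; last by rewrite /= update2_j //; congr Bzero; lia.
  split=> //; split=> //; rewrite /= ?update2_id //.
    by rewrite -{1}di -dj update2_id.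
  by rewrite update2_i update2_j //; split; lia.
- move=> [di dj hc]; have [ij|ij] := eqVneq i j.
    subst j; pose p' := modify p i i true (ea p i + c) (eb p i - c) true (ea p i + c) (eb p i - c).
    have [hp' ed hA] : [/\ in_F d r p', dl p = dl p' & agree_off (pred1 i) p p'].
      by apply: modify1_valid => //; lia.
    exists (CurveIII i p'); split; last first.
      by rewrite /= !update2_i ifF; [congr Binf; lia|lia].
    split=> //; split=> //.
    by move/(congr1 (fun q => ea q i)); rewrite /= update2_i; lia.
  pose p' := modify p i j true (ea p i) (eb p i + c) true (ea p j) (eb p j - c).
  have [hp' hA] : in_F d r p' /\ agree_off (pred2 i j) p p'.
    by apply: modify_valid => //; rewrite ?di ?dj //; lia.
  exists (CurveIIb i j p'); split; last by rewrite /= update2_j //; congr Binf; lia.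
  split=> //; split=> //; rewrite /= ?update2_id //.
    by rewrite -{1}di -dj update2_id.
  by rewrite update2_i update2_j //; split; lia.
Qed.

End LabelOf.

(** * The correspondence *)

Section Correspondence.
Variables (k : closedFieldType) (n : nat).
Local Notation K := (ratfun k).
Local Notation zvar := (@zvar k).
Local Notation cst := (@cst k).
Local Notation premor := (premor k n).
Implicit Types (U : chart) (p : triple n) (C : curve n) (phi psi : premor) (x y : basis_label n).
Local Notation "''e_' i" := (delta_mx 0 i : 'rV[_]_n)
  (at level 8, i at level 2, format "''e_' i").

(* Simplification would turn basis elements into matches on the chart. *)
Local Arguments basis_vec : simpl never.

Lemma basis_vec_row p x U (f : K) :
  basis_vec k p x U (f *: 'e_(row_of x)) =
  (if acts x U then f * zvar ^ label_exponent p x else 0) *: 'e_(col_of x).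
Proof.
apply/rowP => j; rewrite basis_vecE !mxE !eqxx /= mulr1.
by case: (acts x U); case: (j == _); rewrite ?mulr1 ?mulr0.
Qed.

Lemma basis_vec_off p x U (f : K) l : l != row_of x -> basis_vec k p x U (f *: 'e_l) = 0.
Proof.
move=> /negPf ne; apply/rowP => j; rewrite basis_vecE !mxE eqxx [row_of x == l]eq_sym ne mulr0 mul0r.
by rewrite if_same.
Qed.

Lemma component_U0 p l a b : dl p l -> (ea p l <= a)%N -> component p U0 l (mono k U0 a b).
Proof.
move=> dll la; rewrite (_ : mono k U0 a b = mono k U0 a (eb p l)); last by rewrite !monoU0.
exact: component_mono.
Qed.

Lemma component_Uinf p l a b : dl p l -> (eb p l <= b)%N -> component p Uinf l (mono k Uinf a b).
Proof.
move=> dll lb; rewrite (_ : mono k Uinf a b = mono k Uinf (ea p l) b); last by rewrite !monoUinf.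
exact: component_mono.
Qed.

Lemma label_row p C :
  pc_i (curve_pencil p C) = row_of (label_of p C) /\
  pc_j (curve_pencil p C) = col_of (label_of p C).
Proof.
by case: C => [i j p'|i j p'|i j p'|i p'] /=; try case: ifP.
Qed.

(** On the charts where the basis element acts, it takes the base term of the
    moving generator exactly to its t term. On the others it is zero, and
    there the t term already lies in the fixed sheaf. *)
Lemma velocity_pencil d r p C U : in_F d r p -> valid_curve d r p C ->
  fixed_sheaf k p U (pencil_velocity k p C U - basis_vec k p (label_of p C) U (pencil_base k p C U)).
Proof.
move=> hp hv; have [ei ej] := label_row p C.
rewrite /pencil_velocity /pencil_base ei ej basis_vec_row -scalerBl; apply: fixed_sheaf_delta.
have z0 := zvar_neq0 k.
have zero l : component p U l (0 : K) by case: (component_submodule k p U l).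
have both l a b : U = Uboth -> dl p l -> component p U l (mono k U a b).
  by move=> -> dll; apply: component_Uboth => //; exact: regular_mono.
have eq0 l (f g : K) : f = g -> component p U l (f - g) by move=> ->; rewrite subrr.
case/(valid_curveP hp): hv {ei ej} => {C} /=.
- move=> i j p' _ _ _ _ _ _ _ _ e; apply: eq0.
  by case: U {zero both}; rewrite ?monoU0 ?monoUinf ?monoUboth -expfzDr //; congr (_ ^ _); lia.
- move=> i j p' _ _ ij di dj _ _ lt e.
  case: U zero both eq0 => zero both eq0 /=.
  + by apply: eq0; case: ifP => _ /=; rewrite !monoU0 -expfzDr //; congr (_ ^ _); lia.
  + by rewrite subr0; apply: component_Uinf => //; case: ifP => _ /=; lia.
  + by rewrite subr0; apply: both.
- move=> i j p' _ _ ij di dj _ _ lt e.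
  case: U zero both eq0 => zero both eq0 /=.
  + by rewrite subr0; apply: component_U0 => //; case: ifP => _ /=; lia.
  + by apply: eq0; case: ifP => _ /=; rewrite !monoUinf -expfzDr //; congr (_ ^ _); lia.
  + by rewrite subr0; apply: both.
- move=> i p' _ _ di _ na e; case: ifP => lt /=; case: U zero both eq0 => zero both eq0 /=.
  + by apply: eq0; rewrite !monoU0 -expfzDr //; congr (_ ^ _); lia.
  + by rewrite subr0; apply: component_Uinf => //; lia.
  + by rewrite subr0; apply: both.
  + by rewrite subr0; apply: component_U0 => //; lia.
  + by apply: eq0; rewrite !monoUinf -expfzDr //; congr (_ ^ _); lia.
  + by rewrite subr0; apply: both.
Qed.

(** The fixed generators with coordinate e_l, l distinct from i, are killed.
    The first generator of a type II curve is x^c (or y^c) times x^a_i y^b_i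
    e_i, and its image is the generator of the column summand. *)
Lemma velocity_mono d r p C U m : in_F d r p -> valid_curve d r p C ->
  m \in curve_monos p C ->
  fixed_sheaf k p U (basis_vec k p (label_of p C) U (mono_vec (xcoord U) (ycoord U) m)).
Proof.
move=> hp hv; have [ei ej] := label_row p C.
have z0 := zvar_neq0 k; have [S0 _ _] := fixed_sheaf_submodule k p U.
have zero l : component p U l (0 : K) by case: (component_submodule k p U l).
rewrite mem_cat => /orP[|/mapP[l]]; last first.
  rewrite mem_filter => /andP[/andP[_ offl] _] ->.
  by rewrite /mono_vec basis_vec_off // -ei; exact: curve_off_neq offl.
case/(valid_curveP hp): hv {ei ej} => {C} //= i j p' _ _ ij di dj _ _ lt e; rewrite !inE => /orP[] /eqP -> /=;
  rewrite /mono_vec /=; try (by rewrite basis_vec_off //= eq_sym).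
- rewrite (basis_vec_row p (Bzero i j _)); apply: fixed_sheaf_delta; case: U {S0} zero => zero //=; try exact: zero.
  rewrite -/(mono k U0 _ _) monoU0 -expfzDr //.
  rewrite (_ : _ + _ = Posz (ea p j)); last by lia.
  by rewrite -(monoU0 k (ea p j) (eb p j)); apply: component_mono.
- rewrite (basis_vec_row p (Binf i j _)); apply: fixed_sheaf_delta; case: U {S0} zero => zero //=; try exact: zero.
  rewrite -/(mono k Uinf _ _) monoUinf -expfzDr //.
  rewrite (_ : _ + _ = - Posz (eb p j)); last by lia.
  by rewrite -(monoUinf k (ea p j) (eb p j)); apply: component_mono.
Qed.

Lemma velocity_label d r p C : in_F d r p -> valid_curve d r p C ->
  velocity (fixed_sheaf k p) (curve_family p C) (basis_vec k p (label_of p C)).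
Proof.
move=> hp hv; apply: (velocityP hp hv).
- exact/basis_vec_is_hom/(label_of_valid hp hv).
- by move=> U c m m'; exact: basis_vecP.
- by move=> U; exact: (velocity_pencil U hp hv).
- by move=> U m; exact: (velocity_mono U hp hv).
Qed.

Lemma corresponds_label d r p C : in_F d r p -> valid_curve d r p C ->
  corresponds k p C (label_of p C).
Proof.
move=> hp hv; exists (basis_vec k p (label_of p C)), 1; split.
- exact: velocity_label hp hv.
- exact: oner_neq0.
- move=> U m _; rewrite /scale_hom cst1 scale1r subrr.
  by case: (fixed_sheaf_submodule k p U).
Qed.

Lemma basis_label_dec x y : {x = y} + {x <> y}.
Proof. by decide equality; apply: eq_comparable. Qed.

(** Distinct labels span distinct lines, by independence of the pair. *)
Lemma basis_vec_line p x y u : valid_label p x -> valid_label p y -> u != 0 ->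
  eq_hom (fixed_sheaf k p) (basis_vec k p y) (scale_hom u (basis_vec k p x)) -> x = y.
Proof.
move=> hx hy u0 e; have [//|ne] := basis_label_dec x y.
pose z (l : 'I_2) := if l == 0 then x else y.
pose c (l : 'I_2) : k := if l == 0 then - u else 1.
have zinj : injective z.
  move=> a b; rewrite /z; case: a => [[|[|//]] ha]; case: b => [[|[|//]] hb] //= h;
    try exact: val_inj; by case: ne; rewrite h.
have hz l : valid_label p (z l) by rewrite /z; case: ifP.
have h : eq_hom (fixed_sheaf k p) (lincomb c (fun l => basis_vec k p (z l))) (@zero_hom k n).
  move=> U m hm; have := e U m hm; congr (fixed_sheaf _ _ _ _).
  rewrite /zero_hom subr0 /lincomb big_ord_recl big_ord1 /scale_hom /c /z /=.
  by rewrite cst1 scale1r rmorphN scaleNr addrC.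
have := independent zinj hz h 0; rewrite /c /= => /eqP.
by rewrite oppr_eq0 (negPf u0).
Qed.

Lemma basis_vec_neq0 p x : valid_label p x ->
  ~ eq_hom (fixed_sheaf k p) (basis_vec k p x) (@zero_hom k n).
Proof.
move=> hx e.
have h : eq_hom (fixed_sheaf k p) (lincomb (fun _ : 'I_1 => 1) (fun=> basis_vec k p x)) (@zero_hom k n).
  by move=> U m hm; rewrite /lincomb big_ord1 cst1 scale1r; exact: e.
have inj1 : injective (fun _ : 'I_1 => x) by move=> a b _; rewrite [a]ord1 [b]ord1.
by have /eqP := independent inj1 (fun _ => hx) h 0; rewrite oner_eq0.
Qed.

Lemma corresponds_unique d r p C x : in_F d r p -> valid_curve d r p C -> valid_label p x ->
  corresponds k p C x -> label_of p C = x.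
Proof.
move=> hp hv hx [phi [u [hphi u0 e]]]; symmetry.
apply: (basis_vec_line hx (label_of_valid hp hv) u0) => U m hm.
have [_ hD _] := fixed_sheaf_submodule k p U.
have := hD _ _ (velocity_unique (velocity_label hp hv) hphi hm) (e U m hm).
by rewrite addrA subrK.
Qed.

Lemma curve_weightP d r p C chi : in_F d r p -> valid_curve d r p C ->
  curve_weight k p C chi <-> has_weight (fixed_sheaf k p) (basis_vec k p (label_of p C)) chi.
Proof.
move=> hp hv; have hvel := velocity_label hp hv; split=> [[phi [h1 _ h3]]|h].
  exact: has_weight_eq (velocity_unique hvel h1) h3.
exists (basis_vec k p (label_of p C)); split=> //.
exact/basis_vec_neq0/(label_of_valid hp hv).
Qed.

Lemma curve_weight_label d r p C chi : in_F d r p -> valid_curve d r p C ->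
  label_weight p (label_of p C) = chi -> curve_weight k p C chi.
Proof.
move=> hp hv <-; apply/(curve_weightP _ hp hv).
exact/basis_vec_weight/(label_of_valid hp hv).
Qed.

(** The relation [corresponds] is the graph of [label_of] on valid curves and
    labels, and [label_of] is a bijection. *)
Lemma one_to_one_label d r p (PC : curve n -> Prop) (PL : basis_label n -> Prop) :
  in_F d r p -> (forall C, PC C -> valid_curve d r p C) -> (forall x, PL x -> valid_label p x) ->
  (forall C, valid_curve d r p C -> PC C <-> PL (label_of p C)) ->
  one_to_one PC PL (corresponds k p).
Proof.
move=> hp hC hL h; split=> [C hPC|x hPL].
  have hv := hC _ hPC; exists (label_of p C); split.
    by split; [apply/h|exact: (corresponds_label hp hv)].
  by move=> x [hx hcor]; exact: (corresponds_unique hp (hC _ hPC) (hL _ hx) hcor).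
have [C [hv e]] := label_of_surj hp (hL _ hPL); subst x.
exists C; split; first by split; [apply/h|exact: (corresponds_label hp hv)].
move=> C' [hPC' hcor]; apply: (label_of_inj hp hv (hC _ hPC')).
by rewrite (corresponds_unique hp (hC _ hPC') (hL _ hPL) hcor).
Qed.

Lemma correspond_block d r p (type : pred (curve n)) (P : rel 'I_n) : in_F d r p ->
  (forall C, valid_curve d r p C ->
     type C = P (row_of (label_of p C)) (col_of (label_of p C))) ->
  correspond_to_block k d r p type P.
Proof.
move=> hp ht; split; last exact: is_basis_block.
apply: (one_to_one_label hp) => [C []//|x []//|C hv].
rewrite ht //; split=> -[] // _ hP; split=> //; exact: label_of_valid hp hv.
Qed.

End Correspondence.

Theorem theorem5 (k : closedFieldType) (d n r : nat) (hr : (r < n)%N)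
    (p : triple n) (hp : in_F d r p) :
  [/\ (* the fixed point and the T-invariant curves through it *)
      [/\ in_quot d r (fixed_sheaf k p),
          forall g, torus_pt g ->
            eq_subsheaf (act_sheaf g (fixed_sheaf k p)) (fixed_sheaf k p)
        & forall C, valid_curve d r p C ->
            [/\ T_invariant_curve d r (curve_value (k := k) p C),
                eq_subsheaf (curve_value p C 1 0) (fixed_sheaf k p)
              & eq_subsheaf (curve_value p C 0 1) (fixed_sheaf k (target C))]],
      (* the T-basis of the tangent space, and the correspondence with it *)
      [/\ is_basis (fixed_sheaf k p) (is_hom (fixed_sheaf k p))
            (valid_label p) (basis_vec k p),
          forall x, valid_label p x ->
            has_weight (fixed_sheaf k p) (basis_vec k p x) (label_weight p x),
          one_to_one (valid_curve d r p) (valid_label p) (corresponds k p)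
        & forall C x, valid_curve d r p C -> valid_label p x ->
            corresponds k p C x -> forall chi : character n,
            curve_weight k p C chi <->
            has_weight (fixed_sheaf k p) (basis_vec k p x) chi],
      (forall i j p', valid_curve d r p (CurveI i j p') ->
         curve_weight k p (CurveI i j p')
           (wt_e j - wt_e i + wt_f *~ ((ea p' j)%:Z - (ea p i)%:Z))) /\
      correspond_to_block k d r p (@typeI n) (blockI p),
      [/\ forall i j p', valid_curve d r p (CurveIIa i j p') ->
            curve_weight k p (CurveIIa i j p')
              (wt_e j - wt_e i + wt_f *~ ((ea p' j)%:Z - (ea p i)%:Z)),
          forall i j p', valid_curve d r p (CurveIIb i j p') ->
            curve_weight k p (CurveIIb i j p')
              (wt_e j - wt_e i + wt_f *~ ((eb p i)%:Z - (eb p' j)%:Z))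
        & correspond_to_block k d r p (@typeII n) (blockII p)]
    & (forall i p', valid_curve d r p (CurveIII i p') ->
         curve_weight k p (CurveIII i p')
           (wt_f *~ ((ea p' i)%:Z - (ea p i)%:Z))) /\
      correspond_to_block k d r p (@typeIII n) (blockIII p)].
Proof.
split.
- split; [exact: in_quot_fixed|by move=> g; exact: act_fixed_sheaf|move=> C hv].
  split; first exact: T_invariant_curve_value.
    exact: (curve_value_start hp hv (oner_neq0 _)).
  exact: (curve_value_end hp hv (oner_neq0 _)).
- split; [exact: is_basis_hom|exact: basis_vec_weight| |].
    by apply: (one_to_one_label k hp) => // C hv; split=> // _; exact: label_of_valid hp hv.
  move=> C x hv hx hcor chi; rewrite -(corresponds_unique hp hv hx hcor).
  exact: (curve_weightP k chi hp hv).
- split; last by apply: correspond_block => // C; exact: typeI_label.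
  by move=> i j p' hv; exact: (curve_weight_label k hp hv).
- split; last by apply: correspond_block => // C; exact: typeII_label.
    move=> i j p' hv; apply: (curve_weight_label k hp hv).
    rewrite /label_weight /=; congr (_ + _ *~ _).
    by case: hv => _ /= [_ _ _ _ [ec lt]]; lia.
  move=> i j p' hv; apply: (curve_weight_label k hp hv).
  rewrite /label_weight /=; congr (_ + _ *~ _).
  by case: hv => _ /= [_ _ _ _ [ec lt]]; lia.
- split; last by apply: correspond_block => // C; exact: typeIII_label.
  move=> i p' hv; apply: (curve_weight_label k hp hv).
  have [hp' /= [_ hA _]] := hv; have /= e := degree_pred1 hp hp' hA.
  by rewrite /label_weight /=; case: ifP => lt /=; rewrite subrr add0r; congr (_ *~ _); lia.
Qed.
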